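(* Let $M$ be a standard $m\times n$ matrix with row and column index sets $R$, $C$ and weights $w_R,w_C$, and let $k$ be a positive integer with $k\le\min(m,n)$. Then $$\mathbb{E}\big[{\min}_k(M)\big]=\sum_{(X,Y)\in J_k(M)}\frac{-\mu\big((X,Y),\hat 1\big)}{w_R(R\setminus X)\,w_C(C\setminus Y)},$$ where $\mu$ is the Möbius function of the poset $\hat J_k(M)$.
   Context: $R=\{1,\dots,m\}$ and $C=\{1,\dots,n\}$ carry positive weight functions $w_R,w_C$; for $X\subseteq R$ put $w_R(X)=\sum_{i\in X}w_R(i)$, similarly for $C$. A random variable is exponential of rate $\alpha$ if $\Pr(x>t)=e^{-\alpha t}$ for $t\ge0$. A standard matrix is a random $m\times n$ matrix $M$ for which there is a fixed set $Z\subseteq R\times C$ of positions with $M(i,j)=0$ for $(i,j)\in Z$, while the entries $M(i,j)$, $(i,j)\notin Z$, are independent, with $M(i,j)$ exponential of rate $w_R(i)w_C(j)$. A $k$-assignment is a set of $k$ positions no two in the same row or column; its cost is the sum of the entries of $M$ at those positions; ${\min}_k(M)$ is the minimum cost of a $k$-assignment. A file is a row or a column. A set of files is a cover of (the zeros of) $M$ if every position in $Z$ lies in some file of the set; a $(k-1)$-cover is a cover consisting of exactly $k-1$ files; a partial $(k-1)$-cover is a subset of some $(k-1)$-cover. A set of files is written as a pair $(X,Y)$ with $X\subseteq R$ its rows and $Y\subseteq C$ its columns. $J_k(M)$ is the set of partial $(k-1)$-covers of the zeros of $M$, and $\hat J_k(M)$ is the poset consisting of $J_k(M)$ ordered by inclusion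 together with an adjoined greatest element $\hat 1$. *)

(* Defs.v *)
From HB Require Import structures.
From mathcomp Require Import all_boot all_order all_algebra.
From mathcomp Require Import all_classical all_reals all_analysis.

Set Implicit Arguments.
Unset Strict Implicit.
Unset Printing Implicit Defensive.

Import Order.TTheory GRing.Theory Num.Theory.
Import numFieldNormedType.Exports.

Local Open Scope ring_scope.

Section Mobius.
Variables (d : Order.disp_t) (T : finPOrderType d).
Implicit Types (x y z : T) (fuel : nat).
Local Open Scope order_scope.

(* The recursion is on the second argument; [fuel] bounds the length of the
   chains in the interval, and #|T| is always enough (see [mobiusE]). *)
Fixpoint mobius_rec fuel x y : int :=
  if fuel is fuel'.+1 then
    if x == y then 1%R
    else if x < y then (- \sum_(z : T | (x <= z < y)%O) mobius_rec fuel' x z)%R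
    else 0%R
  else 0%R.

Definition mobius x y : int := mobius_rec #|T| x y.

Lemma mobius_rec_fuel n1 n2 x y :
  (#|[pred z : T | (z <= y)%O]| <= n1)%N -> (#|[pred z : T | (z <= y)%O]| <= n2)%N ->
  mobius_rec n1 x y = mobius_rec n2 x y.
Proof.
have gt0 t : (0 < #|[pred z : T | (z <= t)%O]|)%N.
  by apply/card_gt0P; exists t; rewrite inE.
elim: n1 n2 y => [|n1 IH] [|n2] y.
- by [].
- by rewrite leqNgt gt0.
- by move=> _; rewrite leqNgt gt0.
move=> h1 h2 /=; case: ifP => // _; case: ifP => // _.
congr (- _)%R; apply: eq_bigr => z /andP[_ zy].
have lt : (#|[pred t : T | (t <= z)%O]| < #|[pred t : T | (t <= y)%O]|)%N.
  apply: proper_card; apply/properP; split.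
    by apply/fintype.subsetP => t; rewrite !inE => tz; apply: le_trans tz (ltW zy).
  by exists y; rewrite !inE ?lexx// lt_geF.
by apply: IH; rewrite -ltnS; apply: leq_trans lt _.
Qed.

Lemma mobiusE x y : mobius x y =
  if x == y then 1%R
  else if x < y then (- \sum_(z : T | (x <= z < y)%O) mobius x z)%R
  else 0%R.
Proof.
rewrite /mobius (@mobius_rec_fuel #|T| #|T|.+1) ?max_card//=; last first.
  by rewrite (leq_trans (max_card _)).
Qed.

End Mobius.

Section AdjoinTop.
Variables (d : Order.disp_t) (T : finPOrderType d).
Local Open Scope order_scope.

(* [Some x] is the element x of T and [None] is the new greatest element. *)
Definition adjoin_top : Type := option T.

HB.instance Definition _ := Finite.on adjoin_top.

Definition adjoin_top_le (x y : adjoin_top) : bool :=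
  match x, y with
  | _, None => true
  | None, Some _ => false
  | Some x, Some y => x <= y
  end.

Fact adjoin_top_le_refl : reflexive adjoin_top_le.
Proof. by case=> [x|] //=. Qed.

Fact adjoin_top_le_anti : antisymmetric adjoin_top_le.
Proof. by case=> [x|] [y|] //= /le_anti ->. Qed.

Fact adjoin_top_le_trans : transitive adjoin_top_le.
Proof. by case=> [y|] [x|] [z|] //=; apply: le_trans. Qed.

HB.instance Definition _ := Order.Le_isPOrder.Build d adjoin_top
  adjoin_top_le_refl adjoin_top_le_anti adjoin_top_le_trans.

Fact adjoin_top_lex1 (x : adjoin_top) : x <= (None : adjoin_top).
Proof. by case: x. Qed.

HB.instance Definition _ := Order.hasTop.Build d adjoin_top adjoin_top_lex1.

End AdjoinTop.

Section Covers.
Variables m n : nat.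

(* A set of files is the pair (X, Y) of its set of rows X and its set of
   columns Y; it is ordered by inclusion, not by a default order on pairs. *)
Definition fileset : Type := ({set 'I_m} * {set 'I_n})%type.

HB.instance Definition _ := Finite.on fileset.

Definition subfileset (F G : fileset) : bool :=
  (F.1 \subset G.1) && (F.2 \subset G.2).

Fact subfileset_refl : reflexive subfileset.
Proof. by move=> F; rewrite /subfileset !subxx. Qed.

Fact subfileset_anti : antisymmetric subfileset.
Proof.
move=> [X Y] [X' Y'] /andP[/andP[/= XX' YY'] /andP[/= X'X Y'Y]].
by congr pair; apply/eqP; rewrite finset.eqEsubset ?XX' ?YY'.
Qed.

Fact subfileset_trans : transitive subfileset.
Proof.
move=> G F H /andP[FG1 FG2] /andP[GH1 GH2].
by rewrite /subfileset (fintype.subset_trans FG1)// (fintype.subset_trans FG2).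
Qed.

Fact fileset_display : Order.disp_t. Proof. exact: Order.Disp tt tt. Qed.

HB.instance Definition _ := Order.Le_isPOrder.Build fileset_display fileset
  subfileset_refl subfileset_anti subfileset_trans.

Variable Z : {set 'I_m * 'I_n}.

Definition covers_zeros (F : fileset) : bool :=
  [forall p in Z, (p.1 \in F.1) || (p.2 \in F.2)].

Definition rcover (r : nat) (F : fileset) : bool :=
  covers_zeros F && ((#|F.1| + #|F.2|)%N == r).

Definition partial_cover (r : nat) (F : fileset) : bool :=
  [exists G : fileset, rcover r G && (F <= G)%O].

(* Truncated k.-1 is the intended k - 1 since k > 0 throughout. *)
Definition Jk (k : nat) : Type := {F : fileset | partial_cover k.-1 F}.

HB.instance Definition _ (k : nat) := Finite.on (Jk k).
HB.instance Definition _ (k : nat) := SubType.on (Jk k).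
HB.instance Definition _ (k : nat) := [SubChoice_isSubPOrder of Jk k by <: with fileset_display].

Definition Jk_hat (k : nat) := adjoin_top (Jk k).

End Covers.

Section Assignments.
Variables (R : realType) (m n : nat).

Definition is_assignment (k : nat) (S : {set 'I_m * 'I_n}) : bool :=
  (#|S| == k) &&
  [forall p in S, forall q in S, (p != q) ==> (p.1 != q.1) && (p.2 != q.2)].

Definition cost (A : 'M[R]_(m, n)) (S : {set 'I_m * 'I_n}) : R :=
  \sum_(p in S) A p.1 p.2.

(* The default value [set0] of the arg min is only used when there is no
   k-assignment, that is when k > min(m, n); see [min_kP]. *)
Definition min_k (k : nat) (A : 'M[R]_(m, n)) : R :=
  cost A [arg min_(S < finset.set0 | is_assignment k S) cost A S]%O.

Lemma assignment_exists k : (k <= minn m n)%N -> exists S, is_assignment k S.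
Proof.
rewrite leq_min => /andP[km kn].
pose f (i : 'I_k) := (widen_ord km i, widen_ord kn i).
have fI : injective f by move=> i j [/ord_inj].
exists [set f i | i : 'I_k]%SET; rewrite /is_assignment card_imset// card_ord eqxx/=.
apply/forall_inP => p /imsetP[i _ ->]; apply/forall_inP => q /imsetP[j _ ->].
apply/implyP; rewrite (inj_eq fI) => ij.
by rewrite -!(inj_eq val_inj)/= ij.
Qed.

Lemma min_kP k (A : 'M[R]_(m, n)) : (k <= minn m n)%N ->
  (exists2 S, is_assignment k S & min_k k A = cost A S) /\
  (forall S, is_assignment k S -> min_k k A <= cost A S).
Proof.
move=> /assignment_exists[S0 S0k]; rewrite /min_k.
rewrite /Order.arg_min /extremum.
case: pickP => [S /andP[Sk /forall_inP Smin]|/=]; first by split; [exists S | ].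
case: (@Order.TotalTheory.arg_minP _ _ _ S0 (is_assignment k) (cost A) S0k).
move=> S Sk Smin /(_ S) /negP[]; apply/andP; split=> //.
by apply/forall_inP => S' /Smin.
Qed.

End Assignments.

Section StandardMatrix.
Context (d : measure_display) (T : measurableType d) (R : realType).
Variable P : probability T R.

(* The product rule over every J \subset D: mutual, not pairwise, independence. *)
Definition independent_RVs (I : finType) (D : {set I}) (X : I -> {RV P >-> R}) :=
  forall (J : {set I}) (B : I -> set R), J \subset D ->
    (forall i, measurable (B i)) ->
    P (\bigcap_(i in [set` J]) X i @^-1` B i)%classic
    = (\prod_(i in J) P (X i @^-1` B i)%classic)%E.

Definition exponential_RV (a : R) (X : {RV P >-> R}) :=
  forall t : R, 0 <= t -> P [set w | t < X w]%classic = (expR (- (a * t)))%:E.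

Definition standard_matrix (m n : nat) (wR : 'I_m -> R) (wC : 'I_n -> R)
    (Z : {set 'I_m * 'I_n}) (M : 'I_m -> 'I_n -> {RV P >-> R}) :=
  [/\ forall i j, (i, j) \in Z -> forall w, M i j w = 0,
      forall i j, (i, j) \notin Z -> exponential_RV (wR i * wC j) (M i j)
    & independent_RVs (~: Z) (fun p => M p.1 p.2)].

Definition sample (m n : nat) (M : 'I_m -> 'I_n -> {RV P >-> R}) (w : T) :
  'M[R]_(m, n) := \matrix_(i, j) M i j w.

End StandardMatrix.

Definition weight (R : realType) (I : finType) (w : I -> R) (X : {set I}) : R :=
  \sum_(i in X) w i.

(* Main.v *)
(* For a set of zeros Y containing Z let f(Y) be the mean minimum when the
   positions of Y are zero, and write Y + j for Y with column j added. Both f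
   and the sum of the theorem are determined by the value 0 at the full set and
   by the numbers sum_j w_C(j) (f(Y) - f(Y + j)). For the sum, inverting the
   Möbius function shows that this number is V(0), where V(H) vanishes when no
   (k-1)-cover of Y contains the set of rows H, and otherwise
   w_R(R - H) V(H) = 1 + sum_(i not in H) w_R(i) V(H + i).
   For f the same is shown by revealing the matrix row by row: condition on the
   rows of H and let F be an optimal cover of the known zeros with the most
   columns. Subtracting t from the entries outside the files of F, and adding t
   to those covered twice, changes the minimum by an explicit amount as long as
   no new zero appears, and by lack of memory the free entries stay exponential
   until one of them, in row i, hits 0 and reveals row i. The distance of the
   conditional mean from V(H) therefore decays exponentially in t, until a known
   entry becomes 0, in which case induction applies, or for ever, in which case
   the distance is 0 because it grows at most linearly. *)

From HB Require Import structures.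
Require Import Defs.
From mathcomp Require Import all_boot all_order all_algebra.
From mathcomp Require Import all_classical all_reals all_analysis.
From mathcomp Require Import measurable_realfun.
From mathcomp Require Import zify ring lra.

Set Implicit Arguments.
Unset Strict Implicit.
Unset Printing Implicit Defensive.

Import Order.TTheory GRing.Theory Num.Theory.
Import numFieldNormedType.Exports.

Local Open Scope ring_scope.

(** * König's theorem *)

Section Konig.
Variables m n : nat.
Implicit Types (G N S Z : {set 'I_m * 'I_n}) (F : fileset m n) (p q : 'I_m * 'I_n).
Implicit Types (X : {set 'I_m}) (Y : {set 'I_n}).

(** The slope, unlike the minimum itself, has a computable drift. Zeroing column j turns [min_k]
    into a (k-1)-minimum off that column, so along a shift by t the number of files of F drops out
    and the slope changes by t w_C(C - F.2). The free entries of row i reach 0 at total rate w_R(i)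
    w_C(C - F.2). The column weight is a common factor, and cancelling it leaves the recursion of V,
    in which neither F nor the known entries occur. The conditional mean is shown to depend on H
    alone while the known zeros match as many rows as if the rows of H were zero; [explored] is this
    invariant, and preserving it shapes the proof. Choosing F with the most columns makes it an
    extreme element of the lattice of optimal covers. Hence F keeps its optimality when a column is
    deleted, a free entry reaching 0 preserves the invariant, and a known entry reaching 0 lowers
    the number of columns of such a cover. The free entries are never raised because the rows of F
    lie in H; where that fails, some row can join H inside a cover of Z with no more files, and it
    is revealed at once, since V then does not change. *)

Definition assignment S : bool :=
  [forall p in S, forall q in S, (p != q) ==> (p.1 != q.1) && (p.2 != q.2)].

Definition nfiles F : nat := (#|F.1| + #|F.2|)%N.

Lemma assignmentP S :
  reflect ({in S &, injective fst} /\ {in S &, injective snd}) (assignment S).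
Proof.
apply: (iffP forall_inP) => [h|[h1 h2] p pS].
  split=> p q pS qS pq; apply/eqP; apply: contraT => npq;
  by have /forall_inP/(_ q qS) := h p pS; rewrite npq/= pq eqxx ?andbF.
apply/forall_inP => q qS; apply/implyP => npq; apply/andP; split.
  by apply: contra npq => /eqP/h1->.
by apply: contra npq => /eqP/h2->.
Qed.

Lemma assignmentS S S' : S \subset S' -> assignment S' -> assignment S.
Proof.
move=> /fintype.subsetP sS /assignmentP[h1 h2]; apply/assignmentP.
by split=> p q /sS pS /sS qS; [apply: h1|apply: h2].
Qed.

Lemma assignmentU1 S p : assignment S ->
  p.1 \notin [set q.1 | q in S]%SET -> p.2 \notin [set q.2 | q in S]%SET ->
  assignment (p |: S)%SET.
Proof.
move=> /assignmentP[h1 h2] p1 p2; apply/assignmentP; split => a b;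
  rewrite !inE => /orP[/eqP->|aS] /orP[/eqP->|bS] //; do ?by [apply: h1|apply: h2].
- by move=> e; case/imsetP: p1; exists b.
- by move=> e; case/imsetP: p1; exists a.
- by move=> e; case/imsetP: p2; exists b.
- by move=> e; case/imsetP: p2; exists a.
Qed.

Lemma coversP Z F :
  reflect (forall p, p \in Z -> (p.1 \in F.1) || (p.2 \in F.2)) (covers_zeros Z F).
Proof. exact: forall_inP. Qed.

Lemma coversS Z Z' F : Z \subset Z' -> covers_zeros Z' F -> covers_zeros Z F.
Proof. by move=> /fintype.subsetP sZ /coversP h; apply/coversP => p /sZ/h. Qed.

Lemma card_assignment_rows S X : assignment S ->
  (#|[set p in S | p.1 \in X]%SET| <= #|X|)%N.
Proof.
case/assignmentP => inj1 _; rewrite -(card_in_imset (f := fst)); last first.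
  by move=> p q; rewrite !inE => /andP[pS _] /andP[qS _]; apply: inj1.
by apply: subset_leq_card; apply/fintype.subsetP => i /imsetP[p]; rewrite inE => /andP[_ ?] ->.
Qed.

Lemma card_assignment_cols S Y : assignment S ->
  (#|[set p in S | p.2 \in Y]%SET| <= #|Y|)%N.
Proof.
case/assignmentP => _ inj2; rewrite -(card_in_imset (f := snd)); last first.
  by move=> p q; rewrite !inE => /andP[pS _] /andP[qS _]; apply: inj2.
by apply: subset_leq_card; apply/fintype.subsetP => i /imsetP[p]; rewrite inE => /andP[_ ?] ->.
Qed.

Lemma assignment_le_cover N F : assignment N -> covers_zeros N F -> (#|N| <= nfiles F)%N.
Proof.
move=> aN /coversP cF.
have NE : N = ([set p in N | p.1 \in F.1] :|: [set p in N | p.2 \in F.2])%SET.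
  by apply/setP => p; rewrite !inE -andb_orr; case: (boolP (p \in N)) => //= /cF.
rewrite {1}NE; apply: leq_trans (leq_card_setU _ _) _.
by apply: leq_add; [apply: card_assignment_rows|apply: card_assignment_cols].
Qed.

(** Ordering covers by more rows and fewer columns, these are the join and the meet. Covers are
    closed under both, and [nfiles_join] says that the number of files is modular, so two optimal
    covers produce two more. *)
Definition row_join F F' : fileset m n := (F.1 :|: F'.1, F.2 :&: F'.2)%SET.
Definition col_join F F' : fileset m n := (F.1 :&: F'.1, F.2 :|: F'.2)%SET.

Lemma nfiles_join F F' :
  (nfiles (row_join F F') + nfiles (col_join F F') = nfiles F + nfiles F')%N.
Proof.
by rewrite /nfiles/= addnACA cardsUI [X in (_ + X)%N]addnC cardsUI addnACA.
Qed.

Lemma orb_join_l (a b c d : bool) : a || b -> c || d -> (a || c) || (b && d).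
Proof. by case: a b c d => [] [] [] []. Qed.

Lemma orb_join_r (a b c d : bool) : a || b -> c || d -> (a && c) || (b || d).
Proof. by case: a b c d => [] [] [] []. Qed.

Lemma covers_row_join Z F F' :
  covers_zeros Z F -> covers_zeros Z F' -> covers_zeros Z (row_join F F').
Proof.
move=> /coversP h /coversP h'; apply/coversP => p pZ; rewrite /= !inE.
by apply: orb_join_l; [apply: h|apply: h'].
Qed.

Lemma covers_col_join Z F F' :
  covers_zeros Z F -> covers_zeros Z F' -> covers_zeros Z (col_join F F').
Proof.
move=> /coversP h /coversP h'; apply/coversP => p pZ; rewrite /= !inE.
by apply: orb_join_r; [apply: h|apply: h'].
Qed.

Lemma covers_setT_rows Z : covers_zeros Z (finset.setT, finset.set0).
Proof. by apply/coversP => p _; rewrite /= inE. Qed.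

Lemma konig_arith (a b c d f : nat) : (a + b = c + d)%N -> (c < f)%N -> (d < f)%N ->
  (f <= b)%N -> (f <= a.+1)%N -> False.
Proof. lia. Qed.

Lemma konig Z : exists N F, [/\ N \subset Z, assignment N, covers_zeros Z F &
  nfiles F = #|N|].
Proof.
have [k] := ubnP #|Z|; elim: k Z => // k IH Z /ltnSE leZ.
have [F cF minF] : exists2 F, covers_zeros Z F &
    forall F', covers_zeros Z F' -> (nfiles F <= nfiles F')%N.
  pose F0 : fileset m n := (finset.setT, finset.set0).
  have c0 : covers_zeros Z F0 by exact: covers_setT_rows.
  by case: (@arg_minnP _ F0 (covers_zeros Z) nfiles c0) => F cF minF; exists F.
have [p /andP[pZ /existsP[F' /andP[cF' le']]]|crit] :=
  pickP [pred p | (p \in Z) && [exists F', covers_zeros (Z :\ p) F' && (nfiles F == nfiles F') &&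
     [forall F'', covers_zeros (Z :\ p) F'' ==> (nfiles F <= nfiles F'')%N]]].
  move: cF' => /andP[cF' /eqP eF'].
  have [|N [F1 [sN aN cF1 eN]]] := IH (Z :\ p); first by move: leZ; rewrite (cardsD1 p) pZ.
  exists N, F; split=> //.
    by apply: fintype.subset_trans sN _; apply: subD1set.
  apply/eqP; rewrite eqn_leq -eN; move/forallP/(_ F1): le'; rewrite cF1/= => ->/=.
  rewrite eN; apply: assignment_le_cover => //; apply: coversS cF.
  by apply: fintype.subset_trans sN _; apply: subD1set.
have crit' p : p \in Z -> exists2 F', covers_zeros (Z :\ p) F' & (nfiles F' < nfiles F)%N.
  move=> pZ; have := crit p; rewrite /= pZ /= => /negbT; rewrite negb_exists => /forallP/(_ F).
  rewrite (coversS (subD1set _ _) cF) eqxx/= negb_forall => /existsP[F'].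
  by rewrite negb_imply -ltnNge => /andP[? ?]; exists F'.
(* Now removing any position lowers the cover number of [Z]. If two positions
   shared a file, the joins of small covers of their complements would give a
   cover of [Z] that is too small. *)
suff aZ : assignment Z.
  exists Z, F; split=> //; apply/eqP; rewrite eqn_leq assignment_le_cover// andbT.
  have cZ : covers_zeros Z ([set p.1 | p in Z]%SET, finset.set0).
    by apply/coversP => p pZ; rewrite /= imset_f.
  by apply: leq_trans (minF _ cZ) _; rewrite /nfiles/= cards0 addn0 leq_imset_card.
have key p q : p \in Z -> q \in Z -> p != q -> (p.1 == q.1) || (p.2 == q.2) -> False.
  move=> pZ qZ npq pq.
  have [Fp cp lp] := crit' p pZ; have [Fq cq lq] := crit' q qZ.
  have ncover r F' : r \in Z -> covers_zeros (Z :\ r) F' -> (nfiles F' < nfiles F)%N ->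
      (r.1 \notin F'.1) && (r.2 \notin F'.2).
    move=> rZ c' l'; rewrite -negb_or; apply: contraL l' => hr; rewrite -leqNgt.
    apply: minF; apply/coversP => s sZ; have [->//|nsr] := eqVneq s r.
    by move/coversP: c'; apply; rewrite !inE nsr.
  have /andP[p1 p2] := ncover p Fp pZ cp lp.
  have /andP[q1 q2] := ncover q Fq qZ cq lq.
  have pq' : (p.1 \in Fq.1) || (p.2 \in Fq.2) by move/coversP: cq; apply; rewrite !inE npq.
  have qp' : (q.1 \in Fp.1) || (q.2 \in Fp.2).
    by move/coversP: cp; apply; rewrite !inE eq_sym npq.
  have other r : r \in Z -> r != p -> r != q ->
      ((r.1 \in Fp.1) || (r.2 \in Fp.2)) /\ ((r.1 \in Fq.1) || (r.2 \in Fq.2)).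
    by move=> rZ rp rq; split; [move/coversP: cp|move/coversP: cq]; apply; rewrite !inE ?rp ?rq.
  case/orP: pq => /eqP e.
    (* The shared row is in neither cover, so each of [p], [q] lies in a column of the other's
       cover: the join that keeps all columns covers [Z] as it stands, and the opposite join needs
       only the shared row added. *)
    have c1 : covers_zeros Z (col_join Fp Fq).
      apply/coversP => r rZ; rewrite /= !inE; have [->|rp] := eqVneq r p.
        by move: pq'; rewrite e (negbTE q1)/= => ->; rewrite ?orbT.
      have [->|rq] := eqVneq r q; first by move: qp'; rewrite -e (negbTE p1)/= => ->; rewrite ?orbT.
      by have [h1 h2] := other r rZ rp rq; apply: orb_join_r.
    have c2 : covers_zeros Z (p.1 |: (row_join Fp Fq).1, (row_join Fp Fq).2)%SET.
      apply/coversP => r rZ; rewrite /= !inE; have [->|rp] := eqVneq r p; first by rewrite eqxx.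
      have [->|rq] := eqVneq r q; first by rewrite e eqxx.
      by have [h1 h2] := other r rZ rp rq; rewrite -orbA orb_join_l ?orbT.
    apply: (konig_arith (nfiles_join Fp Fq) lp lq (minF _ c1)).
    by apply: leq_trans (minF _ c2) _; rewrite /nfiles/= cardsU1 -addnA -add1n leq_add2r leq_b1.
  have c1 : covers_zeros Z (row_join Fp Fq).
    apply/coversP => r rZ; rewrite /= !inE; have [->|rp] := eqVneq r p.
      by move: pq'; rewrite e (negbTE q2) orbF => ->; rewrite ?orbT.
    have [->|rq] := eqVneq r q; first by move: qp'; rewrite -e (negbTE p2) orbF => ->; rewrite ?orbT.
    by have [h1 h2] := other r rZ rp rq; apply: orb_join_l.
  have c2 : covers_zeros Z ((col_join Fp Fq).1, p.2 |: (col_join Fp Fq).2)%SET.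
    apply/coversP => r rZ; rewrite /= !inE; have [->|rp] := eqVneq r p; first by rewrite eqxx !orbT.
    have [->|rq] := eqVneq r q; first by rewrite e eqxx !orbT.
    by have [h1 h2] := other r rZ rp rq; rewrite orbCA orb_join_r ?orbT.
  have := nfiles_join Fp Fq; rewrite addnC => nj.
  apply: (konig_arith nj lp lq (minF _ c1)).
  by apply: leq_trans (minF _ c2) _; rewrite /nfiles/= cardsU1 addnCA -add1n leq_add2r leq_b1.
apply/assignmentP; split=> p q pZ qZ e; apply/eqP; apply: contraT => npq.
  by case: (key p q pZ qZ npq); rewrite e eqxx.
by case: (key p q pZ qZ npq); rewrite e eqxx orbT.
Qed.

End Konig.

(** * Exchange arguments and the cost of a shift along a cover *)

Section Exchange.
Variables (R : realType) (m n : nat).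
Implicit Types (N S D : {set 'I_m * 'I_n}) (F : fileset m n) (p q : 'I_m * 'I_n).
Implicit Types (X : {set 'I_m}) (Y : {set 'I_n}) (A B : 'M[R]_(m, n)).

Lemma cost_setD1 A S p : p \in S -> cost A S = A p.1 p.2 + cost A (S :\ p).
Proof. by move=> pS; rewrite /cost (big_setD1 p). Qed.

Lemma cost_setU1 A S p : p \notin S -> cost A (p |: S)%SET = A p.1 p.2 + cost A S.
Proof. by move=> pS; rewrite /cost big_setU1. Qed.

Lemma cost_ge0 A S : (forall i j, 0 <= A i j) -> 0 <= cost A S.
Proof. by move=> A0; apply: sumr_ge0. Qed.

Lemma cost_swap A S p e : assignment S -> e \in S -> p \notin S ->
  p.1 \notin [set q.1 | q in S :\ e]%SET -> p.2 \notin [set q.2 | q in S :\ e]%SET ->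
  [/\ assignment (p |: (S :\ e))%SET, #|(p |: (S :\ e))%SET| = #|S| &
   cost A (p |: (S :\ e))%SET = cost A S - A e.1 e.2 + A p.1 p.2].
Proof.
move=> aS eS pS p1 p2; have pSe : p \notin S :\ e by rewrite !inE negb_and pS orbT.
split.
- by apply: assignmentU1 => //; apply: assignmentS aS; apply: subD1set.
- by rewrite cardsU1 pSe (cardsD1 e S) eS.
- by rewrite cost_setU1// (cost_setD1 A eS); ring.
Qed.

(** Among the assignments in [S :|: N] of the same size and no dearer than [S], take one with the
    largest overlap with [N]. If a position of [N] lacked its row or its column, exchanging it for
    the position in conflict, or for any position outside [N] when there is no conflict, would not
    raise the cost and would enlarge the overlap. *)
Lemma nested_assignment B N S : (forall i j, 0 <= B i j) ->
  assignment N -> (forall p, p \in N -> B p.1 p.2 = 0) ->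
  assignment S -> (#|N| <= #|S|)%N ->
  exists S', [/\ assignment S', #|S'| = #|S|, S' \subset S :|: N,
    cost B S' <= cost B S &
    forall p, p \in N -> p.1 \in [set q.1 | q in S']%SET /\ p.2 \in [set q.2 | q in S']%SET].
Proof.
move=> B0 aN zN aS leNS.
pose P S' := [&& assignment S', #|S'| == #|S|, S' \subset S :|: N & (cost B S' <= cost B S)%R].
have PS : P S by rewrite /P aS eqxx finset.subsetUl lexx.
case: (@arg_maxnP _ S P (fun S' => #|(S' :&: N)%SET|) PS) => S' /and4P[aS' /eqP cS' sS' coS'] maxS'.
exists S'; split=> // p pN.
apply/andP; apply: contraT; rewrite negb_and => pS'.
have pnS' : p \notin S' by apply: contraL pS' => pS'; rewrite negb_or !negbK !imset_f.
suff [e [eS' eN p1 p2]] : exists e, [/\ e \in S', e \notin N,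
    p.1 \notin [set q.1 | q in S' :\ e]%SET & p.2 \notin [set q.2 | q in S' :\ e]%SET].
  have [a1 a2 a3] := cost_swap B aS' eS' pnS' p1 p2.
  have PT : P (p |: (S' :\ e))%SET.
    rewrite /P a1 a2 cS' eqxx/= a3 (zN p pN) addr0; apply/andP; split.
      apply/fintype.subsetP => q; rewrite !inE => /orP[/eqP->|/andP[_ qS']]; first by rewrite pN orbT.
      by move/fintype.subsetP: sS' => /(_ q qS'); rewrite !inE.
    by apply: le_trans coS'; rewrite gerBl.
  have /= := maxS' _ PT; rewrite [X in is_true X]leqNgt => /negP[].
  apply: proper_card; apply/properP; split.
    apply/fintype.subsetP => q; rewrite !inE => /andP[qS' qN]; rewrite qN qS' !andbT.
    by apply/orP; right; apply: contra eN => /eqP<-.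
  by exists p; rewrite !inE ?eqxx ?pN//= negb_and pnS'.
have [i1 i2] := assignmentP _ aS'; have [j1 j2] := assignmentP _ aN.
have H1 e : (forall q, q \in S' -> q.1 = p.1 -> q = e) -> p.1 \notin [set q.1 | q in S' :\ e]%SET.
  by move=> h; apply/imsetP => -[q]; rewrite !inE => /andP[/eqP qe qS'] /esym/(h q qS').
have H2 e : (forall q, q \in S' -> q.2 = p.2 -> q = e) -> p.2 \notin [set q.2 | q in S' :\ e]%SET.
  by move=> h; apply/imsetP => -[q]; rewrite !inE => /andP[/eqP qe qS'] /esym/(h q qS').
have N1 : p.1 \notin [set q.1 | q in S']%SET -> forall q, q \in S' -> q.1 = p.1 -> False.
  by move=> h q qS' e; case/imsetP: h; exists q.
have N2 : p.2 \notin [set q.2 | q in S']%SET -> forall q, q \in S' -> q.2 = p.2 -> False.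
  by move=> h q qS' e; case/imsetP: h; exists q.
have [p1|p1] := boolP (p.1 \in [set q.1 | q in S']%SET).
  have p2 : p.2 \notin [set q.2 | q in S']%SET by move: pS'; rewrite p1.
  case/imsetP: (p1) => e eS' pe; exists e; split=> //.
  - apply: contra pnS' => eN; suff -> : p = e by [].
    by apply: j1.
  - by apply: H1 => q qS' qe; apply: i1; rewrite ?qe.
  - by apply: H2 => q qS' /(N2 p2 q qS').
have [p2|p2] := boolP (p.2 \in [set q.2 | q in S']%SET).
  case/imsetP: (p2) => e eS' pe; exists e; split=> //.
  - apply: contra pnS' => eN; suff -> : p = e by [].
    by apply: j2.
  - by apply: H1 => q qS' /(N1 p1 q qS').
  - by apply: H2 => q qS' qe; apply: i2; rewrite ?qe.
have /fintype.subsetPn[e eS' eN] : ~~ (S' \subset N).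
  apply: contraL (leNS) => sub; rewrite -ltnNge -cS'; apply: proper_card.
  by apply/properP; split=> //; exists p.
exists e; split=> //.
- by apply: H1 => q qS' /(N1 p1 q qS').
- by apply: H2 => q qS' /(N2 p2 q qS').
Qed.

(** Each file of the cover holds at most one position of [N]; equality of the counts leaves no file
    empty. *)
Lemma tight_cover_rows N F : assignment N -> covers_zeros N F -> #|N| = nfiles F ->
  F.1 \subset [set p.1 | p in N]%SET /\ F.2 \subset [set p.2 | p in N]%SET.
Proof.
move=> aN /coversP cF eN; have [i1 i2] := assignmentP _ aN.
pose N1 := [set p in N | p.1 \in F.1]%SET; pose N2 := [set p in N | p.2 \in F.2]%SET.
have NE : N = (N1 :|: N2)%SET.
  by apply/setP => p; rewrite !inE -andb_orr; case: (boolP (p \in N)) => //= /cF.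
have le12 : (#|F.1| + #|F.2| <= #|N1| + #|N2|)%N.
  by rewrite -[X in (X <= _)%N]eN {1}NE leq_card_setU.
have le1 : (#|N1| <= #|F.1|)%N by exact: card_assignment_rows.
have le2 : (#|N2| <= #|F.2|)%N by exact: card_assignment_cols.
have sub1 : [set p.1 | p in N1]%SET \subset F.1.
  by apply/fintype.subsetP => i /imsetP[p]; rewrite inE => /andP[_ ?] ->.
have sub2 : [set p.2 | p in N2]%SET \subset F.2.
  by apply/fintype.subsetP => i /imsetP[p]; rewrite inE => /andP[_ ?] ->.
have c1 : #|[set p.1 | p in N1]%SET| = #|N1|.
  by apply: card_in_imset => p q; rewrite !inE => /andP[pN _] /andP[qN _]; apply: i1.
have c2 : #|[set p.2 | p in N2]%SET| = #|N2|.
  by apply: card_in_imset => p q; rewrite !inE => /andP[pN _] /andP[qN _]; apply: i2.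
split.
  have /eqP <- : [set p.1 | p in N1]%SET == F.1 by rewrite finset.eqEcard sub1 c1/=;
    rewrite -(leq_add2r #|F.2|) (leq_trans le12)// leq_add2l.
  by apply: imsetS; apply/fintype.subsetP => p; rewrite inE => /andP[].
have /eqP <- : [set p.2 | p in N2]%SET == F.2 by rewrite finset.eqEcard sub2 c2/=;
  rewrite -(leq_add2l #|F.1|) (leq_trans le12)// leq_add2r.
by apply: imsetS; apply/fintype.subsetP => p; rewrite inE => /andP[].
Qed.

(** The value is 1, 0 or -1 at a position in no, one or two files of [F]; adding a multiple of it is
    the dual update of the Hungarian method. *)
Definition excess F p : R := 1 - (p.1 \in F.1)%:R - (p.2 \in F.2)%:R.

Lemma sum_excess F S : \sum_(p in S) excess F p =
  #|S|%:R - #|[set p in S | p.1 \in F.1]%SET|%:R - #|[set p in S | p.2 \in F.2]%SET|%:R.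
Proof.
have sc (P : pred ('I_m * 'I_n)) : \sum_(p in S) (P p)%:R = #|[set p in S | P p]%SET|%:R :> R.
  rewrite -sum1_card natr_sum big_mkcond [RHS]big_mkcond/=; apply: eq_bigr => p _.
  by rewrite inE; case: (p \in S); case: (P p).
rewrite /excess !sumrB (sc (fun p => p.1 \in F.1)) (sc (fun p => p.2 \in F.2)).
by rewrite -(sum1_card (mem S)) natr_sum.
Qed.

(* [D] is the region in which assignments are sought, in practice the whole
   matrix or the complement of a column. *)
Section Shift.
Variables (D N : {set 'I_m * 'I_n}) (F : fileset m n) (d : R) (B B' : 'M[R]_(m, n)).
Hypotheses (d0 : 0 <= d) (B'0 : forall i j, 0 <= B' i j).
Hypotheses (ND : N \subset D) (aN : assignment N).
Hypotheses (zN : forall p, p \in N -> B' p.1 p.2 = 0).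
Hypotheses (cN : covers_zeros N F) (eN : #|N| = nfiles F).
Hypothesis BE : forall p, p \in D -> B p.1 p.2 = B' p.1 p.2 + d * excess F p.

Lemma cost_shift S : S \subset D -> cost B S = cost B' S + d * \sum_(p in S) excess F p.
Proof.
move=> /fintype.subsetP SD; rewrite /cost mulr_sumr -big_split/=.
by apply: eq_bigr => p /SD/BE.
Qed.

Lemma cost_shift_ge S : S \subset D -> assignment S ->
  cost B' S + d * (#|S|%:R - (nfiles F)%:R) <= cost B S.
Proof.
move=> SD aS; rewrite cost_shift// sum_excess lerD2l ler_wpM2l// /nfiles natrD.
have := card_assignment_rows F.1 aS; have := card_assignment_cols F.2 aS.
by rewrite -!(ler_nat R); lra.
Qed.

(** [nested_assignment] turns [S] into an assignment meeting every row and column of [N], hence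
    every file of [F]; for such an assignment the estimate behind [cost_shift_ge] is sharp. *)
Lemma cost_shift_le S : S \subset D -> assignment S -> (#|N| <= #|S|)%N ->
  exists S', [/\ S' \subset D, assignment S', #|S'| = #|S| &
    cost B S' <= cost B' S + d * (#|S|%:R - (nfiles F)%:R)].
Proof.
move=> SD aS leS; have [S' [aS' cS' sS' coS' h]] := nested_assignment B'0 aN zN aS leS.
have S'D : S' \subset D.
  by apply: fintype.subset_trans sS' _; rewrite finset.subUset SD.
exists S'; split=> //; rewrite cost_shift//; apply: lerD => //.
rewrite ler_wpM2l// sum_excess cS' /nfiles natrD.
have [t1 t2] := tight_cover_rows aN cN eN.
have r1 : (#|F.1| <= #|[set p in S' | p.1 \in F.1]%SET|)%N.
  apply: leq_trans (leq_imset_card fst _); apply: subset_leq_card.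
  apply/fintype.subsetP => i iF; move/fintype.subsetP: t1 => /(_ i iF)/imsetP[p pN ip].
  have [/imsetP[q qS' pq] _] := h p pN; apply/imsetP; exists q; last by rewrite ip.
  by rewrite inE qS' -pq -ip.
have r2 : (#|F.2| <= #|[set p in S' | p.2 \in F.2]%SET|)%N.
  apply: leq_trans (leq_imset_card snd _); apply: subset_leq_card.
  apply/fintype.subsetP => i iF; move/fintype.subsetP: t2 => /(_ i iF)/imsetP[p pN ip].
  have [_ /imsetP[q qS' pq]] := h p pN; apply/imsetP; exists q; last by rewrite ip.
  by rewrite inE qS' -pq -ip.
by move: r1 r2; rewrite -!(ler_nat R); lra.
Qed.

End Shift.

End Exchange.

(** * Minimum assignment costs *)

Section MinK.
Variables (R : realType) (m n k : nat).
Hypothesis (k_gt0 : (0 < k)%N) (k_le : (k <= minn m n)%N).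
Implicit Types (N S D : {set 'I_m * 'I_n}) (F : fileset m n) (p q : 'I_m * 'I_n).
Implicit Types (A B : 'M[R]_(m, n)).

Lemma min_k_le A S : assignment S -> #|S| = k -> min_k k A <= cost A S.
Proof. by move=> aS cS; apply: (min_kP A k_le).2; rewrite /is_assignment cS eqxx. Qed.

Lemma min_k_ex A : exists S, [/\ assignment S, #|S| = k & min_k k A = cost A S].
Proof.
by have [[S /andP[/eqP cS aS] e] _] := min_kP A k_le; exists S.
Qed.

Lemma min_k_ge0 A : (forall i j, 0 <= A i j) -> 0 <= min_k k A.
Proof. by move=> A0; have [S [_ _ ->]] := min_k_ex A; apply: cost_ge0. Qed.

Lemma min_k_lip_le A B : min_k k A <= min_k k B + \sum_i \sum_j `|A i j - B i j|.
Proof.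
have [S [aS cS ->]] := min_k_ex B; apply: le_trans (min_k_le A aS cS) _.
rewrite -lerBlDl /cost -sumrB pair_bigA/= [leRHS](bigID (mem S))/=.
rewrite -[leLHS]addr0; apply: lerD; last by apply: sumr_ge0.
by apply: ler_sum => p _; apply: ler_norm.
Qed.

Lemma min_k_lip A B : `|min_k k A - min_k k B| <= \sum_i \sum_j `|A i j - B i j|.
Proof.
rewrite ler_norml [X in _ && X]lerBlDl min_k_lip_le andbT lerNl opprB lerBlDl.
apply: le_trans (min_k_lip_le B A) _.
by rewrite lerD2l; apply: ler_sum => i _; apply: ler_sum => j _; rewrite distrC.
Qed.

Lemma assignment_sub_card N r : (r <= #|N|)%N -> assignment N ->
  exists S, [/\ assignment S, S \subset N & #|S| = r].
Proof.
move=> rN aN; pose S := [set p in take r (enum N)]%SET.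
have SN : S \subset N.
  by apply/fintype.subsetP => p; rewrite inE => /mem_take; rewrite mem_enum.
exists S; split=> //; first exact: assignmentS aN.
rewrite cardsE; have /card_uniqP -> : uniq (take r (enum N)) by rewrite take_uniq ?enum_uniq.
by rewrite size_take -cardE; case: ltngtP rN.
Qed.

Lemma min_k_eq0 A N : (forall i j, 0 <= A i j) -> assignment N -> (k <= #|N|)%N ->
  (forall p, p \in N -> A p.1 p.2 = 0) -> min_k k A = 0.
Proof.
move=> A0 aN kN zN; have [S [aS /fintype.subsetP SN cS]] := assignment_sub_card kN aN.
apply/eqP; rewrite eq_le min_k_ge0// andbT; apply: le_trans (min_k_le A aS cS) _.
by rewrite /cost big1// => p /SN/zN.
Qed.

Definition zcol (j : 'I_n) A : 'M[R]_(m, n) := \matrix_(i, l) if l == j then 0 else A i l.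

Lemma zcol_ge0 j A : (forall i l, 0 <= A i l) -> forall i l, 0 <= zcol j A i l.
Proof. by move=> A0 i l; rewrite mxE; case: ifP. Qed.

Lemma free_row S : (#|S| < m)%N -> exists i, i \notin [set p.1 | p in S]%SET.
Proof.
move=> Sm; apply/existsP; rewrite -negb_forall; apply: contraL Sm => /forallP h.
rewrite -leqNgt -[X in (X <= _)%N]card_ord.
apply: leq_trans (leq_imset_card (fun p => p.1) S); apply: subset_leq_card.
by apply/fintype.subsetP => i _; apply: h.
Qed.

Lemma cost_zcol j A S : (forall p, p \in S -> p.2 != j) -> cost (zcol j A) S = cost A S.
Proof. by move=> h; apply: eq_bigr => p pS; rewrite mxE (negbTE (h p pS)). Qed.

(** With column [j] zeroed, a (k-1)-assignment avoiding that column extends to k positions at no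
    cost: since k - 1 < m, some row is still free for the new position. *)
Lemma min_k_zcol_le j A S : assignment S -> #|S| = k.-1 -> (forall p, p \in S -> p.2 != j) ->
  min_k k (zcol j A) <= cost A S.
Proof.
move=> aS cS Sj; have Sm : (#|S| < m)%N.
  by rewrite cS prednK//; apply: leq_trans k_le _; apply: geq_minl.
have [i iS] := free_row Sm.
have jS : j \notin [set p.2 | p in S]%SET.
  by apply/imsetP => -[p pS e]; have := Sj p pS; rewrite e eqxx.
have pS : (i, j) \notin S by apply: contra iS => iS; apply/imsetP; exists (i, j).
rewrite -(cost_zcol A Sj).
have -> : cost (zcol j A) S = cost (zcol j A) ((i, j) |: S)%SET.
  by rewrite cost_setU1// mxE eqxx add0r.
by apply: min_k_le; [apply: assignmentU1|rewrite cardsU1 pS cS add1n prednK].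
Qed.

(** The converse drops from an optimal assignment its position in column [j], or any position if it
    has none there. *)
Lemma min_k_zcol_ex j A : (forall i l, 0 <= A i l) ->
  exists S, [/\ assignment S, #|S| = k.-1, forall p, p \in S -> p.2 != j &
    cost A S <= min_k k (zcol j A)].
Proof.
move=> A0; have [S [aS cS ->]] := min_k_ex (zcol j A).
have [/imsetP[p pS pj]|jS] := boolP (j \in [set p.2 | p in S]%SET).
  exists (S :\ p); have h q : q \in S :\ p -> q.2 != j.
    rewrite !inE => /andP[qp qS]; apply: contra qp => /eqP e; apply/eqP.
    by have [_ i2] := assignmentP _ aS; apply: i2; rewrite ?e.
  split=> //; first by apply: assignmentS aS; apply: subD1set.
    by have := cardsD1 p S; rewrite pS cS => ->.
  by rewrite (cost_setD1 _ pS) -(cost_zcol A h) lerDr zcol_ge0.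
have [p pS] : exists p, p \in S by apply/card_gt0P; rewrite cS.
have h q : q \in S -> q.2 != j.
  by move=> qS; apply: contra jS => /eqP<-; apply/imsetP; exists q.
exists (S :\ p); split.
- by apply: assignmentS aS; apply: subD1set.
- by have := cardsD1 p S; rewrite pS cS => ->.
- by move=> q; rewrite !inE => /andP[_]; apply: h.
- by rewrite cost_zcol// (cost_setD1 _ pS) lerDr.
Qed.

Lemma min_k_shift N F d B B' : 0 <= d -> (forall i j, 0 <= B' i j) ->
  assignment N -> (forall p, p \in N -> B' p.1 p.2 = 0) ->
  covers_zeros N F -> #|N| = nfiles F ->
  (forall p, B p.1 p.2 = B' p.1 p.2 + d * excess R F p) -> (nfiles F <= k)%N ->
  min_k k B = min_k k B' + d * (k%:R - (nfiles F)%:R).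
Proof.
move=> d0 B'0 aN zN cN eN BE Fk.
have NT : N \subset finset.setT by exact: finset.subsetT.
have BE' p : p \in finset.setT -> B p.1 p.2 = B' p.1 p.2 + d * excess R F p by [].
apply/eqP; rewrite eq_le; apply/andP; split.
  have [S [aS cS ->]] := min_k_ex B'.
  have [|S' [_ aS' cS' h]] := cost_shift_le d0 B'0 NT aN zN cN eN BE' (finset.subsetT S) aS.
    by rewrite eN cS.
  by move: h; rewrite cS => h; apply: le_trans h; apply: min_k_le => //; rewrite cS'.
have [S [aS cS ->]] := min_k_ex B.
apply: le_trans (cost_shift_ge d0 BE' (finset.subsetT S) aS).
by rewrite cS lerD2r min_k_le.
Qed.

(** The argument of [min_k_shift] for (k-1)-assignments avoiding column [j], in the region [D]
    outside that column, where [F] acts as [F] without [j]. *)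
Lemma min_k_zcol_shift j N F d B B' : 0 <= d -> (forall i j, 0 <= B i j) ->
  (forall i j, 0 <= B' i j) ->
  assignment N -> (forall p, p \in N -> B' p.1 p.2 = 0) -> (forall p, p \in N -> p.2 != j) ->
  covers_zeros N F -> #|N| = nfiles (F.1, F.2 :\ j) ->
  (forall p, B p.1 p.2 = B' p.1 p.2 + d * excess R F p) -> (nfiles (F.1, F.2 :\ j) <= k.-1)%N ->
  min_k k (zcol j B) = min_k k (zcol j B') + d * ((k.-1)%:R - (nfiles (F.1, F.2 :\ j))%:R).
Proof.
move=> d0 B0 B'0 aN zN Nj cN eN BE Fk; set Fj := (F.1, F.2 :\ j) in eN Fk *.
pose D := [set p : 'I_m * 'I_n | p.2 != j]%SET.
have ND : N \subset D by apply/fintype.subsetP => p pN; rewrite inE Nj.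
have BE' p : p \in D -> B p.1 p.2 = B' p.1 p.2 + d * excess R Fj p.
  by rewrite inE => pj; rewrite BE /excess /Fj/= !inE pj.
have cN' : covers_zeros N Fj.
  by apply/coversP => p pN; rewrite /Fj/= !inE Nj//=; move/coversP: cN; apply.
apply/eqP; rewrite eq_le; apply/andP; split.
  have [S [aS cS Sj h]] := min_k_zcol_ex j B'0.
  have SD : S \subset D by apply/fintype.subsetP => p pS; rewrite inE Sj.
  have [|S' [/fintype.subsetP S'D aS' cS' h']] := cost_shift_le d0 B'0 ND aN zN cN' eN BE' SD aS.
    by rewrite eN cS.
  apply: le_trans (le_trans h' _); last by rewrite cS lerD2r.
  by apply: min_k_zcol_le; rewrite ?cS' ?cS// => p /S'D; rewrite inE.
have [S [aS cS Sj h]] := min_k_zcol_ex j B0.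
have SD : S \subset D by apply/fintype.subsetP => p pS; rewrite inE Sj.
apply: le_trans (le_trans (cost_shift_ge d0 BE' SD aS) h).
by rewrite cS lerD2r min_k_zcol_le.
Qed.

Variable wC : 'I_n -> R.

(* The mean of the slope is the right-hand side of a recursion on the set of
   zeros: zeroing column [j] of a sample adds that column to the zeros. *)
Definition slope A : R := \sum_j wC j * (min_k k A - min_k k (zcol j A)).

(** If [j] is in [F.2], both k and the number of files drop by one on zeroing column [j], so the two
    minima change equally. Otherwise only k drops, and their difference changes by [d]. Hence just
    the columns outside [F] contribute. *)
Lemma slope_shift N (Nj : 'I_n -> {set 'I_m * 'I_n}) F d B B' :
  0 <= d -> (forall i j, 0 <= B i j) -> (forall i j, 0 <= B' i j) ->
  assignment N -> (forall p, p \in N -> B' p.1 p.2 = 0) ->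
  covers_zeros N F -> #|N| = nfiles F ->
  (forall j, [/\ assignment (Nj j), forall p, p \in Nj j -> B' p.1 p.2 = 0,
     forall p, p \in Nj j -> p.2 != j, covers_zeros (Nj j) F &
     #|Nj j| = nfiles (F.1, F.2 :\ j)]) ->
  (forall p, B p.1 p.2 = B' p.1 p.2 + d * excess R F p) -> (nfiles F < k)%N ->
  slope B = slope B' + d * weight wC (~: F.2).
Proof.
move=> d0 B0 B'0 aN zN cN eN hj BE Fk.
rewrite /slope /weight mulr_sumr [X in _ + X]big_mkcond -big_split/=; apply: eq_bigr => j _.
have [a1 a2 a3 a4 a5] := hj j.
have nE : nfiles F = ((j \in F.2) + nfiles (F.1, F.2 :\ j))%N.
  by rewrite /nfiles/= (cardsD1 j F.2) addnCA.
rewrite (min_k_shift d0 B'0 aN zN cN eN BE (ltnW Fk)).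
rewrite (min_k_zcol_shift d0 B0 B'0 a1 a2 a3 a4 a5 BE); last first.
  by rewrite -ltnS prednK//; apply: leq_ltn_trans Fk; rewrite nE leq_addl.
have kE : k%:R = (k.-1)%:R + 1 :> R by rewrite natr1 prednK.
rewrite kE nE natrD inE; case: (j \in F.2) => /=; ring.
Qed.

Lemma slope_eq0 A N : (forall i j, 0 <= A i j) -> assignment N -> (k <= #|N|)%N ->
  (forall p, p \in N -> A p.1 p.2 = 0) -> slope A = 0.
Proof.
move=> A0 aN kN zN; rewrite /slope big1// => j _.
rewrite (min_k_eq0 A0 aN kN zN) (min_k_eq0 (zcol_ge0 j A0) aN kN) ?subr0 ?mulr0//.
by move=> p /zN e; rewrite mxE e; case: ifP.
Qed.

Lemma slope_lip A B : `|slope A - slope B| <=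
  (2 * \sum_j `|wC j|) * \sum_i \sum_j `|A i j - B i j|.
Proof.
rewrite /slope -sumrB; apply: le_trans (ler_norm_sum _ _ _) _.
have -> : 2 * (\sum_j `|wC j|) * (\sum_i \sum_j `|A i j - B i j|) =
    \sum_j `|wC j| * (2 * \sum_i \sum_j `|A i j - B i j|) by rewrite -mulr_suml; ring.
apply: ler_sum => j _; rewrite -mulrBr normrM ler_wpM2l//.
have h1 := min_k_lip A B.
have h2 : `|min_k k (zcol j A) - min_k k (zcol j B)| <= \sum_i \sum_j `|A i j - B i j|.
  apply: le_trans (min_k_lip _ _) _; apply: ler_sum => i _; apply: ler_sum => l _.
  by rewrite !mxE; case: ifP; rewrite ?subr0 ?normr0.
set a := min_k k A in h1 *; set b := min_k k B in h1 *.
set c := min_k k _ in h2 *; set e := min_k k _ in h2 *.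
set s := \sum_i _ in h1 h2 *.
by rewrite ler_norml; move: h1 h2; rewrite !ler_norml; lra.
Qed.

End MinK.

(** * Exploring the matrix row by row *)

Section Exploration.
Variables (R : realType) (m n : nat) (Z : {set 'I_m * 'I_n}).
Implicit Types (N S D : {set 'I_m * 'I_n}) (F G : fileset m n) (p q : 'I_m * 'I_n).
Implicit Types (A B : 'M[R]_(m, n)) (H L : {set 'I_m}) (i : 'I_m) (j : 'I_n).

Definition covered_once F p : bool := (p.1 \in F.1) (+) (p.2 \in F.2).

(** A position covered twice would be counted by its row and by its column, forcing the cover to
    have more files than [N] has positions. *)
Lemma tight_cover_once N F p : assignment N -> covers_zeros N F -> #|N| = nfiles F ->
  p \in N -> covered_once F p.
Proof.
move=> aN /coversP cF eN pN; have := cF p pN; rewrite /covered_once.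
case p1: (p.1 \in F.1); case p2: (p.2 \in F.2) => //= _; exfalso.
pose N1 := [set p in N | p.1 \in F.1]%SET; pose N2 := [set p in N | p.2 \in F.2]%SET.
have NE : N = (N1 :|: N2)%SET.
  by apply/setP => q; rewrite !inE -andb_orr; case: (boolP (q \in N)) => //= /cF.
have := cardsUI N1 N2; rewrite -NE => e.
have le1 : (#|N1| <= #|F.1|)%N by exact: card_assignment_rows.
have le2 : (#|N2| <= #|F.2|)%N by exact: card_assignment_cols.
have : (0 < #|(N1 :&: N2)%SET|)%N by apply/card_gt0P; exists p; rewrite !inE pN p1 p2.
have := leq_add le1 le2; rewrite -e eN /nfiles -[leqRHS]addn0 leq_add2l.
by rewrite leqn0 => /eqP->.
Qed.

Lemma nfiles_join_le F G s : (nfiles F <= s)%N -> (nfiles G <= s)%N ->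
  ((s <= nfiles (col_join F G))%N -> (nfiles (row_join F G) <= s)%N) /\
  ((s <= nfiles (row_join F G))%N -> (nfiles (col_join F G) <= s)%N).
Proof.
move=> Fs Gs; have e := nfiles_join F G.
have le := leq_add Fs Gs; rewrite -e in le; split => h.
  by rewrite -(leq_add2r s); apply: leq_trans le; rewrite leq_add2l.
by rewrite -(leq_add2l s); apply: leq_trans le; rewrite leq_add2r.
Qed.

Definition zero_set H A : {set 'I_m * 'I_n} :=
  [set p | if p.1 \in H then A p.1 p.2 == 0 else p \in Z]%SET.

(* [H] is the set of rows already explored, whose entries are known to be those
   of [A]; the condition says that the zeros match as many rows as if the rows
   of [H] consisted of zeros only. *)
Definition explored (s : nat) H A : Prop := exists N F,
  [/\ N \subset zero_set H A, assignment N & #|N| = s] /\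
  [/\ covers_zeros Z F, H \subset F.1 & (nfiles F <= s)%N].

Lemma covers_zero_set H A F : covers_zeros Z F -> H \subset F.1 ->
  covers_zeros (zero_set H A) F.
Proof.
move=> /coversP cF /fintype.subsetP HF; apply/coversP => p; rewrite inE.
by case: ifP => [/HF->//|_ /cF].
Qed.

Lemma explored_nfiles s H A G : explored s H A -> covers_zeros (zero_set H A) G ->
  (s <= nfiles G)%N.
Proof.
move=> [N [F [[sN aN <-] _]]] cG; apply: assignment_le_cover => //.
exact: coversS cG.
Qed.

Lemma explored_init H A : H = finset.set0 -> exists s, explored s H A.
Proof.
move=> ->; have [N [F [sN aN cF eF]]] := konig Z.
exists #|N|, N, F; split; split=> //; last by rewrite eF.
  apply: fintype.subset_trans sN _; apply/fintype.subsetP => p pZ.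
  by rewrite !inE.
exact: finset.sub0set.
Qed.

(** The row belongs to a cover with at most [s] files, so its entries cannot raise the matching
    number, and its zeros at [Z] already suffice for the old matching. *)
Lemma exploredU1 s H A A' i F : explored s H A ->
  [/\ covers_zeros Z F, H \subset F.1 & (nfiles F <= s)%N] -> i \in F.1 -> i \notin H ->
  (forall i' j, i' \in H -> A' i' j = A i' j) ->
  (forall j, (i, j) \in Z -> A' i j = 0) ->
  explored s (i |: H) A'.
Proof.
move=> [N [_ [[sN aN cN] _]]] [cF HF nF] iF iH AA' A'Z.
exists N, F; split; split=> //; last by rewrite finset.subUset finset.sub1set iF.
apply: fintype.subset_trans sN _; apply/fintype.subsetP => -[i' j]; rewrite !inE /=.
case: (boolP (i' \in H)) => [i'H|i'H]; first by rewrite orbT AA'.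
by rewrite orbF; have [->/A'Z->//|] := eqVneq i' i.
Qed.

(** In this case a further row can be revealed with the same [s], whatever its entries off [Z]; see
    [exploredU1]. *)
Definition row_extendable (s : nat) H :=
  [exists F, [&& covers_zeros Z F, H \proper F.1 & (nfiles F <= s)%N]].

Section Step.
Variables (s : nat) (H : {set 'I_m}) (A : 'M[R]_(m, n)).
Hypothesis stA : explored s H A.

Definition max_cover F := [/\ covers_zeros (zero_set H A) F, nfiles F = s &
  forall G, covers_zeros (zero_set H A) G -> (nfiles G <= s)%N -> (#|G.2| <= #|F.2|)%N].

Lemma max_cover_ex : exists F, max_cover F.
Proof.
have [N [F [_ [cF HF nF]]]] := stA.
pose P G := covers_zeros (zero_set H A) G && (nfiles G <= s)%N.
have PF : P F by rewrite /P nF covers_zero_set.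
case: (@arg_maxnP _ F P (fun G => #|G.2|) PF) => G /andP[cG nG] maxG.
exists G; split=> //.
  by apply/eqP; rewrite eqn_leq nG (explored_nfiles stA).
by move=> G' cG' nG'; apply: maxG; rewrite /P cG' nG'.
Qed.

Variable F : fileset m n.
Hypothesis maxF : max_cover F.

(** These zeros have excess 0, so they are the ones that survive a shift along [F]. *)
Definition single_zeros : {set 'I_m * 'I_n} := [set p in zero_set H A | covered_once F p]%SET.

Lemma single_zeros_matching : exists N,
  [/\ N \subset single_zeros, assignment N & #|N| = s].
Proof.
have [N [_ [[sN aN cN] _]]] := stA; have [cF nF _] := maxF.
exists N; split=> //; apply/fintype.subsetP => p pN; rewrite inE (fintype.subsetP sN)//=.
apply: tight_cover_once pN => //; last by rewrite cN.
exact: coversS cF.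
Qed.

Lemma single_zeros_nfiles G : covers_zeros single_zeros G -> (s <= nfiles G)%N.
Proof.
have [N [sN aN <-]] := single_zeros_matching => cG; apply: assignment_le_cover => //.
exact: coversS cG.
Qed.

(* Zeros covered twice by [F] do not constrain the optimal covers: this is why
   they may be destroyed by the shift. *)
Lemma max_cover_cols G : covers_zeros single_zeros G -> (nfiles G <= s)%N ->
  G.2 \subset F.2 /\ F.1 \subset G.1.
Proof.
move=> cG nG; have [cF nF hF] := maxF.
have cj : covers_zeros (zero_set H A) (col_join F G).
  apply/coversP => p pz; rewrite /= !inE.
  move/coversP: cF => /(_ p pz) pF; case: (boolP (covered_once F p)) => pc.
    have : p \in single_zeros by rewrite inE pz pc.
    by move=> pS; move/coversP: cG => /(_ p pS); apply: orb_join_r.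
  by move: pF pc; rewrite /covered_once; case: (p.1 \in F.1); case: (p.2 \in F.2) => //=; rewrite ?orbT.
have cr : covers_zeros single_zeros (row_join F G).
  apply: covers_row_join => //; apply: coversS cF.
  by apply/fintype.subsetP => p; rewrite inE => /andP[].
have [_ h] := @nfiles_join_le F G s (eq_leq nF) nG.
have {h} nj := h (single_zeros_nfiles cr).
have hj := hF _ cj nj.
have e2 : F.2 = (col_join F G).2.
  by apply/eqP; rewrite finset.eqEcard hj andbT /= finset.subsetUl.
have e1 : (F.1 :&: G.1)%SET = F.1.
  apply/eqP; rewrite finset.eqEcard finset.subsetIl /=.
  have := explored_nfiles stA cj; have e2' : (F.2 :|: G.2)%SET = F.2 by rewrite [RHS]e2.
  by rewrite -nF /nfiles/= e2' leq_add2r.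
split; last by rewrite -e1 finset.subsetIr.
by rewrite e2 /= finset.subsetUr.
Qed.

(** The cover witnessing [explored] contains [H], and without an extension its rows are exactly [H];
    the rows of [F] are contained in those of any optimal cover. Entries outside [H] therefore never
    have excess -1. *)
Lemma max_cover_rows : ~~ row_extendable s H -> F.1 \subset H.
Proof.
move=> nex; have [N [F' [_ [cF' HF' nF']]]] := stA.
have [|_ s1] := @max_cover_cols F' _ nF'.
  apply: coversS (covers_zero_set A cF' HF').
  by apply/fintype.subsetP => p; rewrite inE => /andP[].
apply: fintype.subset_trans s1 _; move: nex; rewrite negb_exists => /forallP/(_ F').
by rewrite cF' nF' andbT/= fintype.properE HF' /= negbK.
Qed.

(** By König's theorem a failure would give a smaller cover [G] of the single zeros off column [j].
    Adding [j] to it covers all single zeros: with fewer than [s] files if [j] is in [F.2], and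
    otherwise with at most [s] files and a column outside [F.2], against [max_cover_cols]. *)
Lemma single_zeros_avoid j : exists Nj, [/\ assignment Nj, Nj \subset single_zeros,
  forall p, p \in Nj -> p.2 != j & #|Nj| = nfiles (F.1, F.2 :\ j)].
Proof.
have [cF nF hF] := maxF.
pose Zj := [set p in single_zeros | p.2 != j]%SET.
have [N [G [sN aN cG eG]]] := konig Zj.
exists N; split=> //.
- by apply: fintype.subset_trans sN _; apply/fintype.subsetP => p; rewrite inE => /andP[].
- by move=> p /(fintype.subsetP sN); rewrite inE => /andP[].
apply/eqP; rewrite eqn_leq; apply/andP; split.
  apply: assignment_le_cover => //; apply/coversP => p /(fintype.subsetP sN).
  rewrite !inE => /andP[/andP[pz _] pj]; rewrite pj /=.
  by move/coversP: cF; apply; rewrite inE.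
rewrite -eG leqNgt; apply/negP => lt.
pose G' : fileset m n := (G.1, j |: G.2)%SET.
have cG' : covers_zeros single_zeros G'.
  apply/coversP => p ps; rewrite /= !inE; have [->|pj] := eqVneq p.2 j; first by rewrite orbT.
  by rewrite /=; move/coversP: cG; apply; rewrite inE ps pj.
have nG' : (nfiles G' <= (nfiles G).+1)%N.
  by rewrite /nfiles/= cardsU1 addnCA -add1n leq_add2r leq_b1.
have nE : s = ((j \in F.2) + nfiles (F.1, F.2 :\ j))%N.
  by rewrite -nF /nfiles/= (cardsD1 j F.2) addnCA.
have := single_zeros_nfiles cG'; case: (boolP (j \in F.2)) => jF.
  rewrite leqNgt (leq_ltn_trans nG')//.
  by rewrite [leqRHS]nE jF add1n ltnS.
move=> _; have [|/fintype.subsetP/(_ j)] := @max_cover_cols G' cG'.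
  by apply: leq_trans nG' _; rewrite [leqRHS]nE (negbTE jF).
by rewrite !inE eqxx (negbTE jF) => /(_ isT).
Qed.

Lemma explored_shift A' : (forall p, p \in single_zeros -> p.1 \in H -> A' p.1 p.2 = 0) ->
  explored s H A'.
Proof.
move=> zA'; have [N [sN aN cN]] := single_zeros_matching.
have [_ [F' [_ hF']]] := stA; exists N, F'; split=> //; split=> //.
apply: fintype.subset_trans sN _; apply/fintype.subsetP => p ps; rewrite inE.
case: (boolP (p.1 \in H)) => pH; first by rewrite zA'.
by move: ps; rewrite !inE (negbTE pH) => /andP[].
Qed.

(** If the new zero raises the matching number, the witnessing cover can afford row [i] as an
    additional file. If not, some optimal cover contains the new zero; its columns lie in [F.2], so
    it uses row [i], and its join with the witnessing cover would extend [H] without exceeding [s]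
    files. *)
Lemma explored_hit A' i j : ~~ row_extendable s H ->
  (forall p, p \in single_zeros -> p.1 \in H -> A' p.1 p.2 = 0) ->
  i \notin H -> j \notin F.2 -> A' i j = 0 -> (forall l, (i, l) \in Z -> A' i l = 0) ->
  exists s', explored s' (i |: H) A'.
Proof.
move=> nex zA' iH jF zij ziZ.
have FH := max_cover_rows nex.
have [cF nF hF] := maxF; have [_ [F' [_ [cF' HF' nF']]]] := stA.
have [N [G [sN aN cG eG]]] := konig ((i, j) |: single_zeros)%SET.
have cG' : covers_zeros single_zeros G by apply: coversS cG; apply: finset.subsetUr.
have [ltG|leG] := ltnP s (nfiles G).
  exists #|N|, N, (i |: F'.1, F'.2)%SET; split; split=> //.
  - apply: fintype.subset_trans sN _; apply/fintype.subsetP => -[i' j'].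
    rewrite !inE /= => /orP[/eqP[-> ->]|/andP[]]; first by rewrite eqxx/= zij.
    case: (boolP (i' \in H)) => [i'H zz cc|i'H zz _].
      by rewrite orbT (zA' (i', j'))//= inE cc andbT inE/= i'H.
    by rewrite orbF; have [e|//] := eqVneq i' i; rewrite e in zz *; rewrite ziZ.
  - apply/coversP => p pZ; rewrite /= !inE -orbA; apply/orP; right.
    by move/coversP: cF'; apply.
  - by apply: finset.setUS.
  - rewrite -eG; apply: leq_trans ltG.
    by rewrite /nfiles/= cardsU1 -addnA -add1n leq_add// leq_b1.
have [/fintype.subsetP GF _] := max_cover_cols cG' leG.
have iG : i \in G.1.
  have : ((i, j).1 \in G.1) || ((i, j).2 \in G.2) by move/coversP: cG; apply; rewrite !inE eqxx.
  by rewrite /= => /orP[//|/GF]; rewrite (negbTE jF).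
case/negP: nex; apply/existsP; exists (row_join G F'); apply/and3P; split.
- apply/coversP => p pZ; rewrite /= !inE; case: (boolP (p.1 \in H)) => pH.
    by rewrite (fintype.subsetP HF' _ pH) orbT.
  apply: orb_join_l; last by move/coversP: cF'; apply.
  have pz : p \in zero_set H A by rewrite inE (negbTE pH).
  move/coversP: cG'; apply; rewrite inE pz /covered_once /=.
  have p1 : p.1 \notin F.1 by apply: contra pH; apply: (fintype.subsetP FH).
  by rewrite (negbTE p1) /=; move/coversP: cF => /(_ p pz); rewrite (negbTE p1).
- apply/properP; split; first by apply: fintype.subset_trans HF' _; apply: finset.subsetUr.
  by exists i => //; rewrite !inE iG.
- have [h _] := nfiles_join_le leG nF'; apply: h.
  apply: single_zeros_nfiles; apply: covers_col_join => //.
  apply: coversS (covers_zero_set A cF' HF').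
  by apply/fintype.subsetP => p; rewrite inE => /andP[].
Qed.

(** A cover with at most [s] files still contains [F.1], and it must take row [i] for the new zero,
    as its columns lie in [F.2]. One more row means one column fewer. This drives the inner
    induction. *)
Lemma explored_new_zero A' i j : 
  (forall p, p \in single_zeros -> p.1 \in H -> A' p.1 p.2 = 0) ->
  i \in H -> i \notin F.1 -> j \notin F.2 -> A' i j = 0 ->
  forall G, covers_zeros (zero_set H A') G -> (nfiles G <= s)%N -> (#|G.2| < #|F.2|)%N.
Proof.
move=> zA' iH iF jF zij G cG nG; have [cF nF hF] := maxF.
have cG' : covers_zeros single_zeros G.
  apply: coversS cG; apply/fintype.subsetP => p ps; rewrite inE.
  case: (boolP (p.1 \in H)) => pH; first by rewrite zA'.
  by move: ps; rewrite !inE (negbTE pH) => /andP[].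
have [/fintype.subsetP GF FG] := max_cover_cols cG' nG.
have iG : i \in G.1.
  have : ((i, j).1 \in G.1) || ((i, j).2 \in G.2).
    by move/coversP: cG; apply; rewrite inE/= iH zij.
  by rewrite /= => /orP[//|/GF]; rewrite (negbTE jF).
have lt : (#|F.1| < #|G.1|)%N by apply: proper_card; apply/properP; split=> //; exists i.
rewrite ltnNge; apply/negP => le; have := leq_add lt le.
by rewrite addSn ltnNge -/(nfiles G) -/(nfiles F) nF nG.
Qed.

End Step.

End Exploration.

(** * Integration over one exponential coordinate *)

Section Coordinates.
Context d (T : measurableType d) (R : realType) (P : probability T R).
Variables (m n : nat) (Z : {set 'I_m * 'I_n}).
Variable X : 'I_m * 'I_n -> T -> R.
Local Open Scope classical_set_scope.

Hypothesis mX : forall p, measurable_fun setT (X p).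
Hypothesis X_ge0 : forall p w, 0 <= X p w.
Hypothesis XZ : forall p w, p \in Z -> X p w = 0.
Hypothesis X_indep : forall (J : {set 'I_m * 'I_n}) (B : 'I_m * 'I_n -> set R),
  J \subset (~: Z)%SET -> (forall p, measurable (B p)) ->
  P (\bigcap_(p in [set` J]) X p @^-1` B p) = (\prod_(p in J) P (X p @^-1` B p))%E.

Definition X_mx w : 'M[R]_(m, n) := \matrix_(i, j) X (i, j) w.

Definition upd (B : 'M[R]_(m, n)) (p : 'I_m * 'I_n) (s : R) : 'M[R]_(m, n) :=
  \matrix_(i, j) if (i, j) == p then s else B i j.

(** Measurability is tested on matrices of measurable functions, so that no sigma-algebra on
    matrices enters. *)
Definition measurable_mxfun (F : 'M[R]_(m, n) -> R) :=
  forall d' (S : measurableType d') (Y : 'I_m -> 'I_n -> S -> R),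
  (forall i j, measurable_fun setT (Y i j)) ->
  measurable_fun setT (fun w => F (\matrix_(i, j) Y i j w)).

Section OneCoordinate.
Variable p : 'I_m * 'I_n.
Hypothesis pZ : p \notin Z.

(** A pi-system generating the sigma-algebra of all entries but [p]. The space with this coarser
    sigma-algebra, [T'], plays the role of the other coordinates. *)
Definition other_cylinders : set (set T) :=
  [set A | exists C : 'I_m * 'I_n -> set R, (forall q, measurable (C q)) /\
     A = \bigcap_(q in [set` (~: Z :\ p)%SET]) X q @^-1` C q].

Notation T' := (g_sigma_algebraType other_cylinders).

Lemma preimage_X_measurable q (C : set R) : measurable C -> measurable (X q @^-1` C).
Proof. by move=> mC; rewrite -[_ @^-1` _]setTI; apply: mX. Qed.

Lemma other_cylinders_measurable : other_cylinders `<=` measurable.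
Proof.
move=> A [C [mC ->]]; apply: fin_bigcap_measurable; first exact: finite_finset.
by move=> q _; apply: preimage_X_measurable.
Qed.

Lemma other_cylinders_setI : setI_closed other_cylinders.
Proof.
move=> A B [C [mC ->]] [C' [mC' ->]]; exists (fun q => C q `&` C' q); split.
  by move=> q; apply: measurableI.
by rewrite -bigcapI.
Qed.

Lemma other_cylinders_setT : other_cylinders setT.
Proof.
exists (fun=> setT); split=> //; rewrite predeqE => w; split=> // _ q _ //.
Qed.

Lemma sub_other A : <<s other_cylinders >> A -> measurable A.
Proof. exact: (smallest_sub (@sigma_algebra_measurable _ T) other_cylinders_measurable). Qed.

(** For fixed [B] both sides are finite measures in [A]; they agree on the pi-system by independence
    of the entries. *)
Lemma indep_cylinder A (B : set R) : <<s other_cylinders >> A -> measurable B ->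
  P (A `&` X p @^-1` B) = (P A * P (X p @^-1` B))%E.
Proof.
move=> sA mB; have mXB := preimage_X_measurable p mB.
have PB0 : 0 <= fine (P (X p @^-1` B)) by apply: fine_ge0.
pose m1 := mrestr P mXB.
pose m2 := mscale (NngNum PB0) P.
have m1E A' : m1 A' = P (A' `&` X p @^-1` B) by [].
have m2E A' : m2 A' = (P A' * P (X p @^-1` B))%E.
  by rewrite /m2 /mscale/= fineK ?fin_num_measure// muleC.
rewrite -m1E -m2E.
apply: (g_sigma_algebra_measure_unique other_cylinders other_cylinders_measurable (fun=> setT)) => //.
- by move=> _; apply: other_cylinders_setT.
- by rewrite bigcup_const//; exists 0%N.
- exact: other_cylinders_setI.
- move=> _ [C [mC ->]]; set A0 := \bigcap_(q in _) _.
  suff : m1 A0 = m2 A0 by []; rewrite m1E m2E /A0.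
  have pJ : p \in (~: Z)%SET by rewrite !inE.
  rewrite (X_indep _ mC); last by apply/fintype.subsetP => q; rewrite !inE => /andP[].
  pose C' q := if q == p then B else C q.
  have mC' q : measurable (C' q) by rewrite /C'; case: ifP.
  transitivity (P (\bigcap_(q in [set` (~: Z)%SET]) X q @^-1` C' q)).
    congr (P _); rewrite predeqE => w; split.
      move=> [h hB] q /= qZ; rewrite /C'; have [->//|qp] := eqVneq q p.
      by apply: h; rewrite /= !inE qp /=; move: qZ; rewrite inE.
    move=> h; split.
      move=> q /=; rewrite !inE => /andP[qp qZ]; have := h q; rewrite /= inE /C' (negbTE qp).
      exact.
    by have := h p pJ; rewrite /C' eqxx.
  rewrite (X_indep _ mC') ?fintype.subxx//.
  rewrite (big_setD1 p pJ)/= {1}/C' eqxx; rewrite [RHS]muleC; congr (_ * _)%E.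
  by apply: eq_bigr => q; rewrite !inE => /andP[qp _]; rewrite /C' (negbTE qp).
- by move=> _; rewrite [ltLHS](_ : _ = m1 setT)// m1E setTI (le_lt_trans (probability_le1 _ _)) ?ltry.
Qed.

Lemma measurable_id_other : measurable_fun setT (id : T -> T').
Proof. by move=> _ A mA; rewrite setTI; apply: sub_other. Qed.

Lemma measurable_X_other q : q != p -> measurable_fun setT (X q : T' -> R).
Proof.
move=> qp _ B mB; rewrite setTI; case: (boolP (q \in Z)) => qZ.
  have [B0|B0] := pselect (B 0).
    rewrite (_ : _ @^-1` _ = setT); first exact: measurableT.
    by rewrite predeqE => w; rewrite /preimage/= XZ.
  rewrite (_ : _ @^-1` _ = set0); first exact: measurable0.
  by rewrite predeqE => w; rewrite /preimage/= XZ.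
apply: sub_sigma_algebra; exists (fun q' => if q' == q then B else setT); split.
  by move=> q'; case: ifP.
rewrite predeqE => w; split.
  by move=> h q' _; have [->|] := eqVneq q' q.
by move=> h; have := h q; rewrite /= !inE qp qZ eqxx; apply.
Qed.

(** The maximum with 0 keeps the matrix nonnegative for every real [s], so that the integrand is
    nonnegative on the whole product space. *)
Definition resample (F : 'M[R]_(m, n) -> R) (s : R) : \bar R :=
  (\int[P]_w (F (upd (X_mx w) p (Num.max 0 s)))%:E)%E.

(** The identity into [T'] and [X p] are independent, so their joint law is a product measure, and
    the claim is Tonelli's theorem for it. *)
Lemma integral_coordinate (F : 'M[R]_(m, n) -> R) :
  measurable_mxfun F -> (forall B : 'M[R]_(m, n), (forall i j, 0 <= B i j) -> 0 <= F B) ->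
  measurable_fun setT (resample F) /\
  (\int[P]_w (F (X_mx w))%:E = \int[P]_w resample F (X p w))%E.
Proof.
move=> mF F0.
have mid := measurable_id_other.
pose idf : {mfun T >-> T'} := HB.pack (id : T -> T') (isMeasurableFun.Build _ _ _ _ _ mid).
have mpsi : measurable_fun setT (fun w : T => (w, X p w) : T' * R).
  by apply/measurable_fun_pairP; split; [exact: mid|exact: mX].
pose psi : {mfun T >-> (T' * R)%type} := HB.pack (fun w : T => (w, X p w) : T' * R)
   (isMeasurableFun.Build _ _ _ _ _ mpsi).
pose Xp : {mfun T >-> R} := HB.pack (X p) (isMeasurableFun.Build _ _ _ _ _ (mX p)).
pose P' : probability _ _ := distribution P idf.
pose mu : probability _ _ := distribution P Xp.
pose law : probability _ _ := distribution P psi.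
pose f (z : T' * R) : \bar R := (F (upd (X_mx z.1) p (Num.max 0 z.2)))%:E.
have f0 z : (0 <= f z)%E.
  rewrite lee_fin; apply: F0 => i j; rewrite !mxE; case: ifP => // _.
  by rewrite le_max lexx.
have mf : measurable_fun setT f.
  apply/measurable_EFinP.
  pose Y i j (z : T' * R) := if (i, j) == p then Num.max 0 z.2 else X (i, j) z.1.
  rewrite (_ : (fun z => _) = (fun z => F (\matrix_(i, j) Y i j z))); last first.
    by apply/funext => z; congr F; apply/matrixP => i j; rewrite !mxE.
  apply: mF => i j; rewrite /Y; case: eqVneq => [_|ijp].
    by apply: measurable_maxr => //; exact: measurable_snd.
  by apply: measurableT_comp; [exact: measurable_X_other|exact: measurable_fst].
have lawE A : measurable A -> (P' \x mu)%E A = law A.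
  apply: product_measure_unique => B C mB mC /=.
  exact: indep_cylinder.
have G_E s : (\int[P']_w f (w, s) = \int[P]_w f (w, s))%E.
  rewrite (@ge0_integral_distribution _ _ _ _ _ P idf (fun w => f (w, s)))//.
  by apply: measurableT_comp => //; exact: pair2_measurable.
have f_X w : f (w, X p w) = (F (X_mx w))%:E.
  rewrite /f/=; congr (F _)%:E; apply/matrixP => i j; rewrite !mxE.
  by case: eqVneq => // ->; rewrite max_r.
have mG := @measurable_fun_fubini_tonelli_G _ _ _ _ _ P' _ mf f0.
have GE : resample F = fubini_G P' f by apply/funext => s; apply/esym/G_E.
split; first by rewrite GE.
transitivity (\int[P]_w f (psi w))%E.
  by apply: eq_integral => w _; rewrite f_X.
rewrite -(@ge0_integral_distribution _ _ _ _ _ P psi f)//.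
transitivity (\int[(P' \x mu)%E]_z f z)%E.
  by apply/esym/eq_measure_integral => A mA _; exact: lawE.
rewrite fubini_tonelli2//.
rewrite (@ge0_integral_distribution _ _ _ _ _ P Xp)//; last first.
  by move=> s; apply: integral_ge0 => w _.
by apply: eq_integral => w' _; rewrite GE.
Qed.

End OneCoordinate.

End Coordinates.

(** * Exponential variables: finite mean and lack of memory *)

Section Exponential.
Context d (T : measurableType d) (R : realType) (P : probability T R).
Local Open Scope classical_set_scope.
Variables (a : R) (X : T -> R).
Hypothesis a_gt0 : 0 < a.
Hypothesis mX : measurable_fun setT X.
Hypothesis X_ge0 : forall w, 0 <= X w.
Hypothesis expX : forall t, 0 <= t -> P [set w | t < X w]%classic = (expR (- (a * t)))%:E.

Let Xf : {mfun T >-> R} := HB.pack X (isMeasurableFun.Build _ _ _ _ _ mX).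

(** The mean is the integral of the tail, and the tail is [a^-1] times the exponential density. *)
Lemma exponential_integrable : P.-integrable setT (EFin \o X).
Proof.
apply/integrableP; split; first exact/measurable_EFinP.
rewrite (eq_integral (EFin \o X)); last by move=> w _; rewrite /= ger0_norm.
have <- : ('E_P[Xf])%E = (\int[P]_w (EFin \o X) w)%E by rewrite unlock.
rewrite ge0_expectation_ccdf//.
apply: (@le_lt_trans _ _ (\int[lebesgue_measure]_(r in `[0%R, +oo[) ((a^-1)%:E * (exponential_pdf a r)%:E))%E).
  apply: ge0_le_integral => //.
  - by apply: measurable_funTS; apply: ccdf_measurable.
  - by apply: measurable_funTS; apply: measurable_funeM; apply/measurable_EFinP; exact: measurable_exponential_pdf.
  - move=> r; rewrite /= in_itv/= andbT => r0.
    rewrite exponential_pdfE// -EFinM mulrA mulVf ?gt_eqF// mul1r.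
    rewrite /ccdf /distribution /pushforward set_itvoy.
    by rewrite (_ : _ @^-1` _ = [set w | r < X w]%classic)// expX// mulNr.
rewrite ge0_integralZl//=.
- apply: (@le_lt_trans _ _ ((a^-1)%:E * (\int[lebesgue_measure]_r (exponential_pdf a r)%:E))%E).
    apply: lee_wpmul2l; first by rewrite lee_fin invr_ge0 ltW.
    apply: ge0_subset_integral => //.
      by apply/measurable_EFinP; exact: measurable_exponential_pdf.
    by move=> r _; rewrite lee_fin exponential_pdf_ge0// ltW.
  by rewrite integral_exponential_pdf// mule1 ltry.
- by apply: measurable_funTS; apply/measurable_EFinP; exact: measurable_exponential_pdf.
- by move=> r _; rewrite lee_fin exponential_pdf_ge0// ltW.
- by rewrite lee_fin invr_ge0 ltW.
Qed.

Lemma measurable_gt t : measurable [set w | t < X w]%classic.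
Proof.
rewrite (_ : [set w | _] = X @^-1` `]t, +oo[)%classic; last first.
  by rewrite predeqE => w; rewrite /preimage/= in_itv/= andbT.
by rewrite -[_ @^-1` _]setTI; apply: mX.
Qed.

(** Both sides are finite measures in [B], so it is enough to compare them on the rays above [s]:
    for s >= t this is the functional equation of the exponential, and for s < t the shifted event
    is certain because [X] is nonnegative. *)
Lemma memoryless_measure t (B : set R) : 0 <= t -> measurable B ->
  P ([set w | t < X w] `&` X @^-1` B)%classic =
  ((expR (- (a * t)))%:E * P ((fun w => (X w + t)%R) @^-1` B)%classic)%E.
Proof.
move=> t0 mB.
have mXt : measurable_fun setT (fun w => X w + t) by exact: measurable_funD.
pose Xt : {mfun T >-> R} := HB.pack (fun w => X w + t) (isMeasurableFun.Build _ _ _ _ _ mXt).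
have mt : measurable (`]t, +oo[%classic : set R) by [].
have e0 : 0 <= expR (- (a * t)) by exact: expR_ge0.
pose m1 := mrestr (distribution P Xf) mt.
pose m2 := mscale (NngNum e0) (distribution P Xt).
have m1E B' : m1 B' = P ([set w | t < X w] `&` X @^-1` B')%classic.
  rewrite /m1 /mrestr /distribution /pushforward; congr (P _).
  by rewrite predeqE => w; rewrite /preimage/= in_itv/= andbT; split => -[].
have m2E B' : m2 B' = ((expR (- (a * t)))%:E * P ((fun w => (X w + t)%R) @^-1` B')%classic)%E by [].
rewrite -m1E -m2E.
have rayP (s : R) : X @^-1` `]s, +oo[ = [set w | s < X w]%classic.
  by rewrite predeqE => w; rewrite /preimage/= in_itv/= andbT.
apply: (measure_unique (@RGenOInfty.G R) (fun k => `](- k%:R)%R, +oo[%classic)) => //.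
- exact: RGenOInfty.measurableE.
- move=> _ _ [x ->] [y ->]; exists (Num.max x y).
  by rewrite predeqE => z; rewrite /= !in_itv/= !andbT gt_max; split => [[-> ->]//|/andP[]].
- by move=> k; exists (- k%:R).
- rewrite -subTset => x _; exists (Num.truncn `|x|).+1 => //=.
  rewrite in_itv/= andbT ltrNl (le_lt_trans (ler_norm _))// normrN.
  by rewrite truncnS_gt.
- move=> _ [s ->]; suff : m1 `]s, +oo[%classic = m2 `]s, +oo[%classic by [].
  rewrite m1E m2E rayP.
  have -> : ((fun w => X w + t) @^-1` `]s, +oo[ = [set w | s - t < X w])%classic.
    by rewrite predeqE => w; rewrite /preimage/= in_itv/= andbT ltrBlDr.
  have [st|ts] := leP t s.
    rewrite (_ : (_ `&` _)%classic = [set w | s < X w]%classic); last first.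
      by rewrite predeqE => w /=; split => [[]//|sX]; split=> //; apply: le_lt_trans sX.
    rewrite !expX ?subr_ge0//; last exact: le_trans st.
    by rewrite -EFinM -expRD; congr (expR _)%:E; ring.
  rewrite (_ : (_ `&` _)%classic = [set w | t < X w]%classic); last first.
    by rewrite predeqE => w /=; split => [[]//|tX]; split=> //; apply: lt_trans tX.
  rewrite (_ : [set w | s - t < X w]%classic = setT); last first.
    rewrite predeqE => w /=; split=> // _; apply: lt_le_trans (X_ge0 w).
    by rewrite subr_lt0.
  by rewrite expX// probability_setT mule1.
- move=> k; rewrite [ltLHS](_ : _ = m1 `](- k%:R)%R, +oo[%classic)// m1E.
  by rewrite (le_lt_trans (probability_le1 _ _)) ?ltry//; apply: measurableI;
    rewrite ?rayP; apply: measurable_gt.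
Qed.

Lemma memoryless t (g : R -> \bar R) : 0 <= t -> measurable_fun setT g ->
  (forall s, (0 <= g s)%E) ->
  (\int[P]_(w in [set w | (t < X w)%R]) g (X w) =
   (expR (- (a * t)))%:E * \int[P]_w g (X w + t)%R)%E.
Proof.
move=> t0 mg g0.
have mXt : measurable_fun setT (fun w => X w + t) by exact: measurable_funD.
pose Xt : {mfun T >-> R} := HB.pack (fun w => X w + t) (isMeasurableFun.Build _ _ _ _ _ mXt).
have mt : measurable (`]t, +oo[%classic : set R) by [].
have e0 : 0 <= expR (- (a * t)) by exact: expR_ge0.
pose m2 := mscale (NngNum e0) (distribution P Xt).
have rayP : X @^-1` `]t, +oo[ = [set w | t < X w]%classic.
  by rewrite predeqE => w; rewrite /preimage/= in_itv/= andbT.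
transitivity (\int[distribution P Xf]_(s in `]t, +oo[) g s)%E.
  rewrite ge0_integral_pushforward//; last exact: measurable_funTS.
  by rewrite rayP.
transitivity (\int[m2]_(s in `]t, +oo[) g s)%E.
  apply: eq_measure_integral => B mB Bt.
  rewrite [RHS](_ : _ = (expR (- (a * t)))%:E * P ((fun w => (X w + t)%R) @^-1` B)%classic)%E//.
  rewrite -memoryless_measure//; congr (P _).
  rewrite predeqE => w; split => [Bw|[]//]; split=> //=.
  by have := Bt _ Bw; rewrite /= in_itv/= andbT.
rewrite ge0_integral_mscale//; last exact: measurable_funTS.
congr (_ * _)%E; rewrite ge0_integral_pushforward//; last exact: measurable_funTS.
(* [X w + t] exceeds [t] exactly where [X w] is positive; the rest is a null set because the tail at
   0 equals 1. *)
have XtP : (fun w => X w + t) @^-1` `]t, +oo[ = (setT `\` [set w | X w <= 0])%classic.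
  rewrite predeqE => w; rewrite /preimage/= in_itv/= andbT ltrDr.
  by split => [X0|[_ /negP]]; [split=> //; apply/negP; rewrite -ltNge|rewrite -ltNge].
have XC : [set w | X w <= 0]%classic = (~` [set w | 0 < X w])%classic.
  by rewrite predeqE => w /=; split => [|/negP]; [move=> h; apply/negP|]; rewrite -leNgt.
rewrite XtP -ge0_negligible_integral//.
- by rewrite XC; apply: measurableC; apply: measurable_gt.
- by apply: measurableT_comp.
- by move=> w _; apply: g0.
- rewrite XC; apply: etrans (probability_setC P (measurable_gt 0)) _.
  by rewrite expX// mulr0 oppr0 expR0 subee.
Qed.

End Exponential.

(** * Nonnegative Lipschitz functions of a matrix and their means *)

Section Nice.
Variables (R : realType) (m n : nat).
Implicit Types (A B : 'M[R]_(m, n)) (F G : 'M[R]_(m, n) -> R) (L : R).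

Definition dist1 A B : R := \sum_i \sum_j `|A i j - B i j|.

(* These properties make the mean finite and stable under small changes of the
   entries. *)
Definition nice L F := [/\ measurable_mxfun F, forall B, (forall i j, 0 <= B i j) -> 0 <= F B,
  0 <= L & forall A B, `|F A - F B| <= L * dist1 A B].

Lemma dist1_upd_le B p s t : dist1 (upd B p s) (upd B p t) <= `|s - t|.
Proof.
rewrite /dist1 (bigD1 p.1)//= (bigD1 p.2)//= !mxE -surjective_pairing eqxx.
rewrite [X in _ + X + _]big1 ?addr0; last first.
  move=> j jp; rewrite !mxE [in X in (_ == X)](surjective_pairing p) xpair_eqE (negbTE jp) andbF.
  by rewrite subrr normr0.
rewrite big1 ?addr0// => i ip; rewrite big1// => j _.
by rewrite !mxE [in X in (_ == X)](surjective_pairing p) xpair_eqE (negbTE ip) subrr normr0.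
Qed.

(** The changes made to a matrix later on (fixing entries or rows, shifting, zeroing a column) act
    entrywise by constants or translations, hence are all instances. *)
Lemma nice_comp L F (phi : 'I_m -> 'I_n -> R -> R) : nice L F ->
  (forall i j, [/\ measurable_fun setT (phi i j), forall x, 0 <= x -> 0 <= phi i j x &
     forall x y, `|phi i j x - phi i j y| <= `|x - y|]) ->
  nice L (fun B => F (\matrix_(i, j) phi i j (B i j))).
Proof.
move=> [mF F0 L0 lF] h; split=> //.
- move=> d' S Y mY.
  rewrite (_ : (fun w => _) = fun w => F (\matrix_(i, j) (phi i j (Y i j w)))).
    by apply: mF => i j; have [m1 _ _] := h i j; apply: measurableT_comp.
  by apply/funext => w; congr F; apply/matrixP => i j; rewrite !mxE.
- by move=> B B0; apply: F0 => i j; rewrite mxE; have [_ h0 _] := h i j; apply: h0.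
- move=> A B; apply: le_trans (lF _ _) _; apply: ler_wpM2l => //.
  by apply: ler_sum => i _; apply: ler_sum => j _; rewrite !mxE; have [_ _ hl] := h i j.
Qed.

Lemma nice_ext L F G : nice L F -> F =1 G -> nice L G.
Proof. by move=> nF /funext <-. Qed.

Lemma nice_upd L F p s : 0 <= s -> nice L F -> nice L (fun B => F (upd B p s)).
Proof.
move=> s0 nF.
apply: (nice_ext (F := fun B => F (\matrix_(i, j) ((if (i, j) == p then fun=> s else id) (B i j))))).
  apply: (nice_comp (phi := fun i j => if (i, j) == p then fun=> s else id)) => // i j.
  by case: ifP => _; split=> // x y; rewrite subrr normr0.
by move=> B; congr F; apply/matrixP => i j; rewrite !mxE; case: ifP.
Qed.

Lemma nice_shift L F (C : 'M[R]_(m, n)) : (forall i j, 0 <= C i j) -> nice L F -> nice L (fun B => F (C + B)).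
Proof.
move=> C0 nF.
apply: (nice_ext (F := fun B => F (\matrix_(i, j) (C i j + B i j)))).
  apply: (nice_comp (phi := fun i j x => C i j + x)) => // i j; split.
  - by apply: measurable_funD.
  - by move=> x x0; apply: addr_ge0.
  - by move=> x y; rewrite opprD addrACA subrr add0r.
by move=> B; congr F; apply/matrixP => i j; rewrite !mxE.
Qed.

End Nice.

Section Expectation.
Context d (T : measurableType d) (R : realType) (P : probability T R).
Variables (m n : nat) (Z : {set 'I_m * 'I_n}).
Variable X : 'I_m * 'I_n -> T -> R.
Variable rate : 'I_m * 'I_n -> R.

Hypothesis mX : forall p, measurable_fun setT (X p).
Hypothesis X_ge0 : forall p w, 0 <= X p w.
Hypothesis XZ : forall p w, p \in Z -> X p w = 0.
Hypothesis X_indep : forall (J : {set 'I_m * 'I_n}) (B : 'I_m * 'I_n -> set R),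
  J \subset (~: Z)%SET -> (forall p, measurable (B p)) ->
  P (\bigcap_(p in [set` J]) X p @^-1` B p)%classic = (\prod_(p in J) P (X p @^-1` B p)%classic)%E.
Hypothesis rate_gt0 : forall p, p \notin Z -> 0 < rate p.
Hypothesis expX : forall p, p \notin Z -> forall t, 0 <= t ->
  P [set w | t < X p w]%classic = (expR (- (rate p * t)))%:E.

Implicit Types (B : 'M[R]_(m, n)) (F G : 'M[R]_(m, n) -> R) (L : R).

Local Notation X_mx := (X_mx X).

Definition expect F : R := (\int[P]_w F (X_mx w))%R.

Lemma X_mx_ge0 w i j : 0 <= X_mx w i j.
Proof. by rewrite mxE. Qed.

Lemma X_integrable p : P.-integrable setT (EFin \o X p).
Proof.
case: (boolP (p \in Z)) => pZ; last exact: (exponential_integrable (rate_gt0 pZ)) (expX pZ).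
rewrite (_ : EFin \o X p = cst 0%E); first exact: integrable0.
by apply/funext => w /=; rewrite XZ.
Qed.

Lemma nice_integrable L F : nice L F -> P.-integrable setT (EFin \o (F \o X_mx)).
Proof.
move=> [mF F0 L0 lF].
pose g w := `|F 0| + L * \sum_i \sum_j X (i, j) w.
have ig : P.-integrable setT (EFin \o g).
  rewrite (_ : EFin \o g = (fun w => `|F 0|%:E + L%:E * (\sum_i \sum_j (X (i, j) w)%:E))%E).
    apply: integrableD => //; first exact: finite_measure_integrable_cst.
    apply: integrableZl => //; apply: integrable_sum => // i _.
    by apply: integrable_sum => // j _; apply: X_integrable.
  apply/funext => w /=; rewrite /g EFinD EFinM -sumEFin; congr (_ + _ * _)%E.
  by apply: eq_bigr => i _; rewrite sumEFin.
apply: le_integrable ig => //.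
  apply/measurable_EFinP; rewrite (_ : F \o _ = fun w => F (\matrix_(i, j) X (i, j) w))//.
  exact: mF.
move=> w _ /=; rewrite lee_fin.
rewrite [leRHS]ger0_norm; last first.
  by rewrite addr_ge0// mulr_ge0//; apply: sumr_ge0 => i _; apply: sumr_ge0.
have := lF (X_mx w) 0.
have -> : dist1 (X_mx w) 0 = \sum_i \sum_j X (i, j) w.
  by apply: eq_bigr => i _; apply: eq_bigr => j _; rewrite !mxE subr0 ger0_norm.
rewrite /g; set s := L * _ => h.
have := ler_normD (F (X_mx w) - F 0) (F 0); rewrite subrK; lra.
Qed.

Lemma expect_cst c : expect (fun=> c) = c.
Proof. by rewrite /expect Rintegral_cst// [X in fine X](_ : _ = 1%E) ?mulr1//; exact: probability_setT. Qed.

Lemma expect_eq F G : (forall B, (forall i j, 0 <= B i j) -> (forall p, p \in Z -> B p.1 p.2 = 0) ->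
  F B = G B) -> expect F = expect G.
Proof.
move=> FG; apply: eq_Rintegral => w _; apply: FG => [i j|p pZ]; first exact: X_mx_ge0.
by rewrite mxE -surjective_pairing XZ.
Qed.

Lemma expect_close L L' F G c : nice L F -> nice L' G ->
  (forall B, (forall i j, 0 <= B i j) -> `|F B - G B| <= c) -> `|expect F - expect G| <= c.
Proof.
move=> nF nG FG; have iF := nice_integrable nF; have iG := nice_integrable nG.
have iB : P.-integrable setT (EFin \o (fun w => F (X_mx w) - G (X_mx w))).
  rewrite (_ : EFin \o _ = (EFin \o (F \o X_mx)) \- (EFin \o (G \o X_mx)))%E.
    exact: integrableB.
  by apply/funext => w /=; rewrite EFinB.
rewrite /expect -RintegralB//.
apply: le_trans (le_normr_Rintegral _ iB) _ => //.
rewrite -[leRHS]expect_cst; apply: le_Rintegral => //.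
- exact: integrable_abse iB.
- exact: finite_measure_integrable_cst.
- by move=> w _; apply: FG => i j; apply: X_mx_ge0.
Qed.

Lemma EFin_expect L F : nice L F -> ((expect F)%:E = \int[P]_w (F (X_mx w))%:E)%E.
Proof.
by move=> nF; rewrite /expect /Rintegral fineK//; apply: integrable_fin_num => //; apply: nice_integrable nF.
Qed.

Local Open Scope classical_set_scope.
Section OneCoordinate.
Variable p : 'I_m * 'I_n.
Hypothesis pZ : p \notin Z.

Lemma resampleE L F s : nice L F -> 0 <= s ->
  resample P X p F s = (expect (fun B => F (upd B p s)))%:E.
Proof. by move=> nF s0; rewrite (EFin_expect (nice_upd p s0 nF)) /resample max_r. Qed.

Lemma integral_coordinateE L F : nice L F ->
  measurable_fun setT (resample P X p F) /\ ((expect F)%:E = \int[P]_w resample P X p F (X p w))%E.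
Proof.
move=> nF; have [mF F0 _ _] := nF.
have [h1 h2] := integral_coordinate mX X_ge0 XZ X_indep pZ mF F0.
by split=> //; rewrite (EFin_expect nF) h2.
Qed.

Lemma expect_upd_cst L F V : nice L F ->
  (forall s, 0 <= s -> expect (fun B => F (upd B p s)) = V) -> expect F = V.
Proof.
move=> nF h; have [_ e] := integral_coordinateE nF.
apply: EFin_inj; rewrite e (eq_integral (cst V%:E)).
  by rewrite integral_cst// [X in (_ * X)%E](_ : _ = 1%E) ?mule1//; exact: probability_setT.
by move=> w _; rewrite (resampleE nF)// h.
Qed.

(** With probability [q] the entry exceeds [t] and is then [t] plus a fresh exponential. Otherwise
    it lies between 0 and [t], and replacing it by 0 costs at most [L * t]. *)
Lemma expect_step L F t q : nice L F -> 0 <= t -> q = expR (- (rate p * t)) ->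
  `|expect F - (q * expect (fun B => F (upd 0 p t + B)) + (1 - q) * expect (fun B => F (upd B p 0)))|
  <= L * t * (1 - q).
Proof.
move=> nF t0 qE; have [mF F0 L0 lF] := nF.
have [mr e] := integral_coordinateE nF.
have C0 : forall i j, 0 <= upd (0 : 'M[R]_(m, n)) p t i j.
  by move=> i j; rewrite !mxE; case: ifP.
have nFt := nice_shift C0 nF.
have [mr' e'] := integral_coordinateE nFt.
have r0 s : (0 <= resample P X p F s)%E.
  apply: integral_ge0 => w _; rewrite lee_fin; apply: F0 => i j; rewrite mxE.
  by case: ifP => _; rewrite ?le_max ?lexx// X_mx_ge0.
have r't s : 0 <= s -> resample P X p (fun B => F (upd 0 p t + B)) s = resample P X p F (s + t).
  move=> s0; rewrite (resampleE nFt)// (resampleE nF) ?addr_ge0//.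
  congr (_%:E); apply: expect_eq => B _ _; congr F; apply/matrixP => i j; rewrite !mxE.
  by case: ifP => _; rewrite ?add0r// addrC.
have mgt : measurable [set w | t < X p w]%classic by apply: measurable_gt.
have e2 : ((expect F)%:E = \int[P]_(w in ~` [set w | (t < X p w)%R]%classic) resample P X p F (X p w) +
    (q * expect (fun B => F (upd 0 p t + B)))%:E)%E.
  have -> : ((q * expect (fun B => F (upd 0 p t + B)))%:E =
      (expR (- (rate p * t)))%:E * \int[P]_w resample P X p F (X p w + t)%R)%E.
    by rewrite EFinM qE e'; congr (_ * _)%E; apply: eq_integral => w _; rewrite r't.
  rewrite -(memoryless (mX p) (X_ge0 p) (expX pZ))// e.
  rewrite -ge0_integral_setU//.
  - by rewrite setUC setUv.
  - exact: measurableC.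
  - by rewrite setUC setUv; apply: measurableT_comp.
  - by rewrite disj_set2E setICl.
have Pc : (P (~` [set w | (t < X p w)%R]%classic) = (1 - q)%:E)%E.
  by apply: etrans (probability_setC P mgt) _; rewrite expX// qE.
set E0 := expect (fun B => F (upd B p 0)).
have q1 : 0 <= 1 - q.
  by rewrite qE subr_ge0 -expR0 ler_expR oppr_le0 mulr_ge0// ltW// rate_gt0.
have bnd w : ~ (t < X p w) -> ((E0 - L * t)%:E <= resample P X p F (X p w) <= (E0 + L * t)%:E)%E.
  move=> /negP; rewrite -leNgt => Xt; rewrite (resampleE nF)// !lee_fin -ler_distl.
  apply: (expect_close (nice_upd p (X_ge0 p w) nF) (nice_upd p (lexx 0) nF)) => B B0.
  apply: le_trans (lF _ _) _; rewrite ler_wpM2l//.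
  by apply: le_trans (dist1_upd_le _ _ _ _) _; rewrite subr0 ger0_norm.
have mres : measurable_fun (~` [set w | t < X p w]%classic) (fun w => resample P X p F (X p w)).
  by apply: measurable_funTS; apply: measurableT_comp.
have mC := measurableC mgt.
set I := (\int[P]_(w in _) _)%E in e2.
have If : I \is a fin_num.
  by move: e2; move: (I) => [r||].
have up : (I <= ((E0 + L * t) * (1 - q))%:E)%E.
  rewrite EFinM -Pc -integral_cst//; apply: ge0_le_integral => //.
  by move=> w /bnd/andP[].
have lo : (((E0 - L * t) * (1 - q))%:E <= I)%E.
  rewrite EFinM -Pc -integral_cst//; apply: le_integral => //.
  - exact: finite_measure_integrable_cst.
  - apply/integrableP; split => //.
    under eq_integral do rewrite gee0_abs//.
    by rewrite -/I -ge0_fin_numE// integral_ge0.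
  - by move=> w; rewrite inE => /bnd/andP[].
move: up lo e2; rewrite -(fineK If) !lee_fin -EFinD => up lo [->].
by rewrite ler_norml; apply/andP; split; lra.
Qed.

End OneCoordinate.

End Expectation.

(** * Analytic estimates along the flow *)

Section Contraction.
Variable R : realType.

Lemma expRN_bounds (x : R) : 0 <= x -> 0 <= 1 - expR (- x) <= x /\
  `|1 - expR (- x) - x| <= x ^+ 2.
Proof.
move=> x0.
have h1 : 1 - x <= expR (- x) by apply: expR_ge1Dx.
have h2 : expR (- x) <= 1 by rewrite -[leRHS]expR0 ler_expR oppr_le0.
have h3 : expR (- x) <= 1 - x + x ^+ 2.
  have h4 : 1 + x <= expR x by apply: expR_ge1Dx.
  have h5 : expR (- x) * expR x = 1 by rewrite -expRD addNr expR0.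
  have h6 : 0 < expR (- x) by apply: expR_gt0.
  have h7 : expR (- x) * (1 + x) <= 1 by rewrite -[leRHS]h5 ler_wpM2l// ltW.
  have h8 : 0 < 1 + x by lra.
  rewrite -(ler_pM2r h8); apply: le_trans h7 _.
  rewrite [leRHS](_ : _ = 1 + x ^+ 3); last by ring.
  by rewrite lerDl exprn_ge0.
split; first lra.
by rewrite ler_norml; lra.
Qed.

Lemma ler_add_invn (x y c : R) : (forall N : nat, x <= y + c / N.+1%:R) -> x <= y.
Proof.
move=> h; apply/ler_addgt0Pr => e e0.
have c1 : 0 < `|c| + 1 by rewrite ltr_wpDl.
pose N := Num.truncn ((`|c| + 1) / e).
apply: le_trans (h N) _; rewrite lerD2l.
have N0 : 0 < N.+1%:R :> R by rewrite ltr0n.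
rewrite ler_pdivrMr//; apply: le_trans (ler_norm _) _.
have : (`|c| + 1) / e < N.+1%:R by apply: truncnS_gt.
by rewrite ltr_pdivrMr// mulrC => h'; lra.
Qed.

(* Discretize [0, T0] into steps of length T0 / N and let N tend to infinity. *)
Lemma exp_contraction (e : R -> R) (lam C T0 : R) : 0 <= lam -> 0 <= T0 ->
  (forall t dt, 0 <= t -> 0 <= dt -> t + dt <= T0 ->
    `|e t - expR (- (lam * dt)) * e (t + dt)| <= C * dt ^+ 2) ->
  `|e 0| <= expR (- (lam * T0)) * `|e T0|.
Proof.
(* [M] steps of length T0 / M, each with an error of at most C (T0 / M)^2, leave a total of C T0^2 /
   M. The bound is carried backwards from [T0]. *)
move=> lam0 T00 h; apply: (@ler_add_invn _ _ (C * T0 ^+ 2)) => N.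
pose M := N.+1; pose dt := T0 / M%:R.
have M0 : 0 < M%:R :> R by rewrite ltr0n.
have dt0 : 0 <= dt by rewrite divr_ge0// ltW.
have dtM : dt * M%:R = T0 by rewrite /dt divfK// gt_eqF.
pose q := expR (- (lam * dt)).
have q0 : 0 <= q by apply: expR_ge0.
have q1 : q <= 1 by rewrite /q -[leRHS]expR0 ler_expR oppr_le0 mulr_ge0.
have C0 : 0 <= C * dt ^+ 2.
  by apply: le_trans (normr_ge0 _) (h 0 dt _ dt0 _) => //; rewrite add0r -dtM ler_peMr// ler1n.
have step j : (j <= M)%N -> `|e (dt * (M - j)%:R)| <= q ^+ j * `|e T0| + j%:R * (C * dt ^+ 2).
  elim: j => [|j IH] jM.
    by rewrite subn0 dtM expr0 mul1r mul0r addr0.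
  have {}IH := IH (ltnW jM).
  have e1 : dt * (M - j.+1)%:R + dt = dt * (M - j)%:R.
    by rewrite -{2}[dt]mulr1 -mulrDr natr1 -subSn// subSS.
  have := h (dt * (M - j.+1)%:R) dt (mulr_ge0 dt0 (ler0n _ _)) dt0.
  rewrite e1 -/q; set a := e _; set b := e (dt * (M - j)%:R) => h1.
  have {h1} : `|a - q * b| <= C * dt ^+ 2.
    by apply: h1; rewrite -dtM ler_wpM2l// ler_nat leq_subr.
  have := ler_normD (a - q * b) (q * b); rewrite subrK normrM (ger0_norm q0) => h2 h3.
  have h4 : q * `|b| <= q * (q ^+ j * `|e T0|) + j%:R * (C * dt ^+ 2).
    apply: le_trans (ler_wpM2l q0 IH) _; rewrite mulrDr lerD2l ler_piMl//.
    by rewrite mulr_ge0.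
  by rewrite exprS -mulrA -natr1 mulrDl mul1r; lra.
have := step M (leqnn _); rewrite subnn mulr0.
have -> : q ^+ M = expR (- (lam * T0)).
  by rewrite /q -expRM_natl -dtM; congr expR; ring.
move=> h1; apply: le_trans h1 _; rewrite lerD2l.
rewrite /dt expr_div_n.
have -> : M%:R * (C * (T0 ^+ 2 / M%:R ^+ 2)) = C * T0 ^+ 2 / M%:R.
  by field; rewrite gt_eqF.
exact: lexx.
Qed.

Lemma exp_beats_linear (x lam a b : R) : 0 < lam -> 0 <= x -> 0 <= a -> 0 <= b ->
  (forall t, 0 <= t -> x <= expR (- (lam * t)) * (a + b * t)) -> x = 0.
Proof.
move=> lam0 x0 a0 b0 h; apply/eqP; rewrite eq_le x0 andbT leNgt; apply/negP => xp.
pose b' := 2 * b / lam; have b'0 : 0 <= b' by apply: divr_ge0; [apply: mulr_ge0|apply: ltW].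
(* Chosen so that x u = x + a + b', whence x u^2 > a + b' u. With lam t = 2 u, b t = b' u and exp (2
   u) >= u^2 this contradicts the hypothesis at [t]. *)
pose u := 1 + (a + b') / x.
have xu : x * u = x + a + b' by rewrite /u; field; rewrite gt_eqF.
have u1 : 1 <= u by rewrite /u lerDl divr_ge0 ?addr_ge0// ltW.
pose t := 2 * u / lam.
have t0 : 0 <= t by rewrite /t divr_ge0 ?mulr_ge0 ?ltW//; lra.
have := h t t0.
have -> : lam * t = u *+ 2 by rewrite /t -mulr_natr; field; rewrite gt_eqF.
have -> : b * t = b' * u by rewrite /t /b'; ring.
have h1 : 1 + u <= expR u by apply: expR_ge1Dx.
have h2 : u ^+ 2 <= expR (u *+ 2).
  by rewrite mulr2n expRD -expr2 ler_pXn2r ?nnegrE ?expR_ge0//; lra.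
move=> h3; have h4 : x * expR (u *+ 2) <= a + b' * u.
  have := ler_wpM2r (expR_ge0 (u *+ 2)) h3.
  by rewrite mulrAC -expRD addNr expR0 mul1r.
have h5 : x * u ^+ 2 <= a + b' * u by apply: le_trans h4; apply: ler_wpM2l.
move: h5; rewrite expr2 mulrA xu.
have : a <= a * u by apply: ler_peMr.
have : x <= x * u by apply: ler_peMr => //.
by nra.
Qed.

End Contraction.

(** * The recursion for the values of sets of rows *)

Section RowValue.
Variables (R : realType) (m n k : nat) (Z : {set 'I_m * 'I_n}).
Variables (wR : 'I_m -> R).
Hypothesis wR_gt0 : forall i, 0 < wR i.
Implicit Types (H L : {set 'I_m}) (F : fileset m n).

(** Stated with fewer than k files, which is easier to use with joins; by [partial_cover_rows]
    padding to exactly k - 1 files makes no difference. *)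
Definition coverable L : bool :=
  [exists F, [&& covers_zeros Z F, L \subset F.1 & (nfiles F < k)%N]].

(* The expected value of the total column weight accumulated until the rows
   drawn, starting with [H], are no longer part of a (k-1)-cover, when each
   row [i] is drawn at rate [wR i]. *)
Definition row_value (V : {set 'I_m} -> R) : Prop :=
  (forall L, ~~ coverable L -> V L = 0) /\
  (forall L, coverable L -> weight wR (~: L) * V L = 1 + \sum_(i in ~: L) wR i * V (i |: L)%SET).

Lemma coverableS L L' : L \subset L' -> coverable L' -> coverable L.
Proof.
move=> sL /existsP[F /and3P[cF LF nF]]; apply/existsP; exists F.
by rewrite cF nF (fintype.subset_trans sL LF).
Qed.

Lemma weight_setC1 L i : i \notin L ->
  weight wR (~: L) = wR i + weight wR (~: (i |: L)).
Proof.
move=> iL; rewrite /weight (big_setD1 i) ?inE//=; congr (_ + _).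
by apply: eq_bigl => l; rewrite !inE negb_or.
Qed.

Lemma weight_ge0 L : 0 <= weight wR L.
Proof. by apply: sumr_ge0 => i _; apply: ltW. Qed.

(** Drawing row [i] excludes nothing. By induction on the complement of [L], the terms with a row
    other than [i] in the equation for [L] agree with those in the equation for [L] with [i];
    subtracting leaves V(L) = V(L + i). *)
Lemma row_value_closure V H i : row_value V ->
  (forall L, H \subset L -> coverable L -> coverable (i |: L)%SET) ->
  forall L, H \subset L -> V (i |: L)%SET = V L.
Proof.
move=> [V0 V1] cl L; have [r] := ubnP #|~: L|; elim: r L => // r IH L /ltnSE leL HL.
have [iL|iL] := boolP (i \in L).
  by congr V; apply/setP => l; rewrite !inE; case: eqVneq => // ->.
have [cL|cL] := boolP (coverable L); last first.
  rewrite !V0//; apply: contra cL; apply: coverableS; exact: finset.subsetUr.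
have ciL := cl L HL cL.
have e1 := V1 _ cL; have e2 := V1 _ ciL.
rewrite (weight_setC1 iL) in e1.
rewrite (big_setD1 i) ?inE//= in e1.
have eS : \sum_(l in ~: L :\ i) wR l * V (l |: L)%SET =
    \sum_(l in ~: (i |: L)) wR l * V (l |: (i |: L))%SET.
  apply: eq_big => [l|l]; first by rewrite !inE negb_or.
  rewrite !inE => /andP[li lL]; congr (_ * _).
  rewrite (_ : l |: (i |: L) = i |: (l |: L))%SET; last by apply/setP => x; rewrite !inE orbCA.
  rewrite IH//; last by apply: fintype.subset_trans HL _; apply: finset.subsetUr.
  apply: leq_trans leL; apply: proper_card; apply/properP; split.
    by rewrite finset.setCS finset.subsetUr.
  by exists l; rewrite !inE ?lL// eqxx.
rewrite eS in e1.
have wi := wR_gt0 i; have W0 := weight_ge0 (~: (i |: L)).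
have Wne : wR i + weight wR (~: (i |: L)) != 0 by rewrite gt_eqF// ltr_wpDr.
apply: (mulfI Wne); rewrite e1 mulrDl e2; ring.
Qed.

End RowValue.

(** * Regularity of the minimum and of the slope *)

Section NiceSlope.
Variables (R : realType) (m n k : nat).
Hypothesis (k_gt0 : (0 < k)%N) (k_le : (k <= minn m n)%N).
Implicit Types (A B : 'M[R]_(m, n)).

Lemma measurable_cost d' (S : measurableType d') (Y : 'I_m -> 'I_n -> S -> R) (s : {set 'I_m * 'I_n}) :
  (forall i j, measurable_fun setT (Y i j)) ->
  measurable_fun setT (fun w => cost (\matrix_(i, j) Y i j w) s).
Proof.
move=> mY; rewrite (_ : (fun w => _) = fun w => \sum_(p <- enum s) Y p.1 p.2 w).
  by apply: measurable_sum.
by apply/funext => w; rewrite /cost big_enum/=; apply: eq_bigr => p _; rewrite mxE.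
Qed.

(** The arg min becomes an iterated binary minimum, for which measurability is an induction on the
    list. *)
Lemma min_k_foldr A (S0 : {set 'I_m * 'I_n}) : is_assignment k S0 ->
  min_k k A = foldr (fun S x => Num.min (cost A S) x) (cost A S0)
    [seq S <- enum {set 'I_m * 'I_n} | is_assignment k S].
Proof.
move=> aS0; have [[S aS eS] minS] := min_kP A k_le.
apply/eqP; rewrite eq_le; apply/andP; split.
  have : all (is_assignment k) [seq S <- enum {set 'I_m * 'I_n} | is_assignment k S].
    exact: filter_all.
  elim: [seq _ <- _ | _] => [_|S' l IH] /=; first exact: minS.
  by move=> /andP[aS' al]; rewrite le_min minS// IH.
rewrite eS; have : S \in [seq S <- enum {set 'I_m * 'I_n} | is_assignment k S].
  by rewrite mem_filter aS mem_enum.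
elim: [seq _ <- _ | _] => [//|S' l IH] /=; rewrite inE => /orP[/eqP->|/IH h].
  by rewrite ge_min lexx.
by rewrite ge_min h orbT.
Qed.

Lemma measurable_min_k : measurable_mxfun (@min_k R m n k).
Proof.
move=> d' S Y mY; have [S0 aS0] := assignment_exists k_le.
rewrite (_ : (fun w => _) = fun w => foldr (fun S x => Num.min (cost (\matrix_(i, j) Y i j w) S) x)
    (cost (\matrix_(i, j) Y i j w) S0) [seq S <- enum {set 'I_m * 'I_n} | is_assignment k S]).
  elim: [seq _ <- _ | _] => [|S' l IH] /=; first exact: measurable_cost.
  by apply: measurable_minr => //; apply: measurable_cost.
by apply/funext => w; rewrite -min_k_foldr.
Qed.

Lemma nice_min_k : nice 1 (@min_k R m n k).
Proof.
split=> //; first exact: measurable_min_k.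
  by move=> B B0; apply: min_k_ge0.
by move=> A B; rewrite mul1r; apply: min_k_lip.
Qed.

Lemma measurable_zcol j : measurable_mxfun (fun A => @min_k R m n k (zcol j A)).
Proof.
move=> d' S Y mY.
rewrite (_ : (fun w => _) = fun w => min_k k (\matrix_(i, l) (if l == j then cst 0 else Y i l) w)).
  by apply: measurable_min_k => i l; case: ifP.
apply/funext => w; congr (min_k k _); apply/matrixP => i l; rewrite !mxE.
by case: ifP.
Qed.

Lemma min_k_zcol_mono j A : (forall i l, 0 <= A i l) -> min_k k (zcol j A) <= min_k k A.
Proof.
move=> A0; have [S [aS cS ->]] := min_k_ex k_le A.
apply: le_trans (min_k_le k_le (zcol j A) aS cS) _.
by apply: ler_sum => p _; rewrite mxE; case: ifP.
Qed.

Variable wC : 'I_n -> R.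
Hypothesis wC_gt0 : forall j, 0 < wC j.

Definition slope_lip_const : R := 2 * \sum_j `|wC j|.

Lemma nice_slope : nice slope_lip_const (slope k wC : 'M[R]_(m, n) -> R).
Proof.
split.
- move=> d' S Y mY; rewrite /slope.
  rewrite (_ : (fun w => _) = fun w => \sum_(j <- enum 'I_n) wC j * (min_k k (\matrix_(i, j) Y i j w) -
     min_k k (zcol j (\matrix_(i, j) Y i j w)))).
    apply: measurable_sum => j; apply: measurable_funM => //; apply: measurable_funB.
      exact: measurable_min_k.
    exact: measurable_zcol.
  by apply/funext => w; rewrite big_enum.
- move=> B B0; apply: sumr_ge0 => j _; rewrite mulr_ge0 ?subr_ge0 ?min_k_zcol_mono//.
  exact: ltW.
- by rewrite mulr_ge0// sumr_ge0.
- by move=> A B; apply: slope_lip.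
Qed.

End NiceSlope.

(** * Partially revealed matrices *)

Section Fuse.
Variables (R : realType) (m n : nat).
Implicit Types (A B : 'M[R]_(m, n)) (H : {set 'I_m}).

(** Averaging over a full fresh sample [B] replaces the conditional mean given that the rows of [H]
    are those of [A]; the independence of the entries makes the two agree. *)
Definition fuse H A B : 'M[R]_(m, n) := \matrix_(i, j) if i \in H then A i j else B i j.

Definition nonneg_on H A := forall i j, i \in H -> 0 <= A i j.

Lemma nice_fuse L (F : 'M[R]_(m, n) -> R) H A : nonneg_on H A -> nice L F ->
  nice L (fun B => F (fuse H A B)).
Proof.
move=> A0 nF.
apply: (nice_ext (F := fun B => F (\matrix_(i, j) ((if i \in H then fun=> A i j else id) (B i j))))).
  apply: (nice_comp (phi := fun i j => if i \in H then fun=> A i j else id)) => // i j.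
  by case: ifP => iH; split=> // [x _|x y]; [exact: A0|rewrite subrr normr0].
by move=> B; congr F; apply/matrixP => i j; rewrite !mxE; case: ifP.
Qed.

Lemma fuse_ge0 H A B : nonneg_on H A -> (forall i j, 0 <= B i j) ->
  forall i j, 0 <= fuse H A B i j.
Proof. by move=> A0 B0 i j; rewrite mxE; case: ifP => // /A0. Qed.

Definition set_row (i : 'I_m) (y : 'I_n -> R) (l : seq 'I_n) B : 'M[R]_(m, n) :=
  \matrix_(i', j) if (i' == i) && (j \in l) then y j else B i' j.

Lemma nice_set_row L (F : 'M[R]_(m, n) -> R) i y l : (forall j, 0 <= y j) -> nice L F ->
  nice L (fun B => F (set_row i y l B)).
Proof.
move=> y0 nF.
apply: (nice_ext (F := fun B => F (\matrix_(i', j)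
    ((if (i' == i) && (j \in l) then fun=> y j else id) (B i' j))))).
  apply: (nice_comp (phi := fun i' j => if (i' == i) && (j \in l) then fun=> y j else id)) => // i' j.
  by case: ifP => iH; split=> // x z; rewrite subrr normr0.
by move=> B; congr F; apply/matrixP => i' j; rewrite !mxE; case: ifP.
Qed.

End Fuse.

(** * First-order expansion of means in many coordinates *)

Section Expectation.
Context d (T : measurableType d) (R : realType) (P : probability T R).
Variables (m n : nat) (Z : {set 'I_m * 'I_n}).
Variable X : 'I_m * 'I_n -> T -> R.
Variable rate : 'I_m * 'I_n -> R.

Hypothesis mX : forall p, measurable_fun setT (X p).
Hypothesis X_ge0 : forall p w, 0 <= X p w.
Hypothesis XZ : forall p w, p \in Z -> X p w = 0.
Hypothesis X_indep : forall (J : {set 'I_m * 'I_n}) (B : 'I_m * 'I_n -> set R),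
  J \subset (~: Z)%SET -> (forall p, measurable (B p)) ->
  P (\bigcap_(p in [set` J]) X p @^-1` B p)%classic = (\prod_(p in J) P (X p @^-1` B p)%classic)%E.
Hypothesis rate_gt0 : forall p, p \notin Z -> 0 < rate p.
Hypothesis expX : forall p, p \notin Z -> forall t, 0 <= t ->
  P [set w | t < X p w]%classic = (expR (- (rate p * t)))%:E.

Implicit Types (B : 'M[R]_(m, n)) (F G : 'M[R]_(m, n) -> R) (L : R).

Local Notation Ex := (expect P X).

Lemma expect_addc L F c : nice L F -> Ex (fun B => F B + c) = Ex F + c.
Proof.
move=> nF; rewrite -[X in _ + X](expect_cst P X c) /expect RintegralD//.
  exact: (nice_integrable mX X_ge0 XZ rate_gt0 expX nF).
exact: finite_measure_integrable_cst.
Qed.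

(** The row is integrated out one entry at a time by [expect_upd_cst]; its entries in [Z] are 0 in
    every sample. *)
Lemma expect_set_row i L F V : nice L F ->
  (forall y : 'I_n -> R, (forall j, 0 <= y j) -> (forall j, (i, j) \in Z -> y j = 0) ->
     Ex (fun B => F (set_row i y (enum 'I_n) B)) = V) -> Ex F = V.
Proof.
move=> nF; elim: (enum 'I_n) => [|j l IH] h.
  have := h (fun=> 0) (fun=> lexx 0) (fun _ _ => erefl) => <-.
  by congr expect; apply/funext => B; congr F; apply/matrixP => i' j; rewrite !mxE andbF.
apply: IH => y y0 yZ.
have [jl|jl] := boolP (j \in l).
  rewrite -(h y y0 yZ); congr expect; apply/funext => B; congr F; apply/matrixP => i' j'.
  by rewrite !mxE inE; have [->|//] := eqVneq j' j; rewrite jl.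
have [ijZ|ijZ] := boolP ((i, j) \in Z).
  rewrite -(h y y0 yZ); apply: (expect_eq P X_ge0 XZ) => B _ BZ; congr F; apply/matrixP => i' j'.
  rewrite !mxE inE; have [->|//] := eqVneq j' j.
  case: eqVneq => [->|//] /=; rewrite (negbTE jl) yZ//.
  exact: BZ ijZ.
have nFy := nice_set_row i l y0 nF.
apply: (expect_upd_cst mX X_ge0 XZ X_indep rate_gt0 expX ijZ nFy) => s s0.
rewrite -(h (fun j' => if j' == j then s else y j')).
- congr expect; apply/funext => B; congr F; apply/matrixP => i' j'.
  rewrite !mxE inE xpair_eqE; have [->|jj] := eqVneq j' j; last by rewrite andbF.
  by rewrite (negbTE jl) andbF /= andbT.
- by move=> j'; case: ifP.
- by move=> j' ijZ'; case: eqVneq => [e|_]; [rewrite e (negbTE ijZ) in ijZ'|apply: yZ].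
Qed.

Definition shift_on (s : seq ('I_m * 'I_n)) (t : R) : 'M[R]_(m, n) :=
  \matrix_(i, j) if (i, j) \in s then t else 0.

Lemma dist1_upd_add p (t : R) B : 0 <= t -> dist1 (upd 0 p t + B) B <= t.
Proof.
move=> t0; apply: le_trans (_ : dist1 (upd (0 : 'M[R]_(m, n)) p t) (upd 0 p 0) <= _); last first.
  by apply: le_trans (dist1_upd_le _ _ _ _) _; rewrite subr0 ger0_norm.
apply: ler_sum => i _; apply: ler_sum => j _; rewrite !mxE addrK.
by case: ifP; rewrite !subr0.
Qed.

(* The first-order effect of resetting the coordinates of [s] one at a time. *)
Lemma expect_multi_step L (v : 'I_m * 'I_n -> R) V (s : seq ('I_m * 'I_n)) :
  0 <= L -> uniq s -> {in s, forall p, p \notin Z} ->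
  forall kappa, 0 <= kappa -> exists2 C, 0 <= C & forall F t, nice L F -> 0 <= t ->
   {in s, forall p, `|Ex (fun B => F (upd B p 0)) - v p| <= kappa * t} ->
   `|(Ex F - V) - (expR (- ((\sum_(p <- s) rate p) * t)) * (Ex (fun B => F (shift_on s t + B)) - V)
      + t * \sum_(p <- s) rate p * (v p - V))| <= C * t ^+ 2.
Proof.
move=> L0; elim: s => [|p s IH] us sZ kappa kappa0.
  exists 0 => // F t nF t0 _; rewrite !big_nil mul0r oppr0 expR0 mulr0 addr0 mul1r.
  rewrite (_ : Ex (fun B => F (shift_on [::] t + B)) = Ex F); last first.
    congr expect; apply/funext => B; congr F; apply/matrixP => i j; rewrite !mxE.
    by rewrite add0r.
  by rewrite subrr normr0 mul0r.
move: us => /= /andP[ps us].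
have sZ' : {in s, forall p, p \notin Z} by move=> q qs; apply: sZ; rewrite inE qs orbT.
have pZ : p \notin Z by apply: sZ; rewrite mem_head.
(* The slack [kappa] exists for this induction: raising entry [p] by [t] moves the means after the
   other resets by at most [L * t]. *)
have [C C0 hC] := IH us sZ' (kappa + L) (addr_ge0 kappa0 L0).
have r0 : 0 < rate p by apply: rate_gt0.
set r := rate p in r0 *.
pose S := \sum_(p <- s) rate p * (v p - V).
(* The summands pay for the error terms bounded in [b1] to [b5] below. *)
exists ((L + kappa) * r + C + r * `|S| + r ^+ 2 * `|v p - V|).
  by do ![apply: addr_ge0 => //]; apply: mulr_ge0 => //; rewrite ?addr_ge0 ?exprn_ge0// ltW.
move=> F t nF t0 hv.
have U0 : forall i j, 0 <= upd (0 : 'M[R]_(m, n)) p t i j.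
  by move=> i j; rewrite !mxE; case: ifP.
have nFp := nice_shift U0 nF.
pose q := expR (- (r * t)).
have rt0 : 0 <= r * t by rewrite mulr_ge0// ltW.
have [/andP[q1 q2] q3] := expRN_bounds rt0; rewrite -/q in q1 q2 q3.
have q0 : 0 <= q by apply: expR_ge0.
have step := @expect_step _ _ _ _ _ _ _ _ _ mX X_ge0 XZ X_indep rate_gt0 expX p pZ L F t q nF t0 erefl.
have vp : `|Ex (fun B => F (upd B p 0)) - v p| <= kappa * t by apply: hv; rewrite mem_head.
have hv' : {in s, forall p', `|Ex (fun B => F (upd 0 p t + upd B p' 0)) - v p'| <= (kappa + L) * t}.
  move=> p' p's; have hp' : `|Ex (fun B => F (upd B p' 0)) - v p'| <= kappa * t.
    by apply: hv; rewrite inE p's orbT.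
  have : `|Ex (fun B => F (upd 0 p t + upd B p' 0)) - Ex (fun B => F (upd B p' 0))| <= L * t.
    apply: (expect_close mX X_ge0 XZ rate_gt0 expX (nice_upd p' (lexx 0) nFp) (nice_upd p' (lexx 0) nF)).
    move=> B B0; have [_ _ _ lF] := nF; apply: le_trans (lF _ _) _; rewrite ler_wpM2l//.
    exact: dist1_upd_add.
  move: hp'; rewrite mulrDl !ler_norml; lra.
have := hC _ t nFp t0 hv'.
rewrite (_ : Ex (fun B => F (upd 0 p t + (shift_on s t + B))) = Ex (fun B => F (shift_on (p :: s) t + B))); last first.
  congr expect; apply/funext => B; congr F; apply/matrixP => i j; rewrite !mxE !inE addrA; congr (_ + _).
  by have [->|_] := eqVneq (i, j) p; rewrite ?(negbTE ps) ?addr0 ?add0r.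
rewrite !big_cons -/S -/r.
have -> : expR (- ((r + \sum_(p <- s) rate p) * t)) = q * expR (- ((\sum_(p <- s) rate p) * t)).
  by rewrite mulrDl opprD expRD.
set E1 := Ex (fun B => F (upd 0 p t + B)) in step *.
set E2 := Ex (fun B => F (shift_on _ t + B)).
set E3 := Ex (fun B => F (upd B p 0)) in step vp.
set Q := expR (- _); set E := expect P X F in step *.
move=> hIH.
have t20 : 0 <= t ^+ 2 by apply: exprn_ge0.
have b1 : `|E - (q * E1 + (1 - q) * E3)| <= L * r * t ^+ 2.
  apply: le_trans step _; rewrite expr2 (_ : L * r * (t * t) = L * t * (r * t)); last by ring.
  by rewrite ler_wpM2l// mulr_ge0.
have b2 : `|(1 - q) * (E3 - v p)| <= kappa * r * t ^+ 2.
  rewrite normrM (ger0_norm q1) (_ : kappa * r * t ^+ 2 = (r * t) * (kappa * t)); last by ring.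
  by apply: ler_pM.
have b3 : `|q * ((E1 - V) - (Q * (E2 - V) + t * S))| <= C * t ^+ 2.
  rewrite normrM (ger0_norm q0); apply: le_trans hIH; rewrite ler_piMl//.
  by lra.
have b4 : `|(1 - q) * (t * S)| <= r * `|S| * t ^+ 2.
  rewrite 2!normrM (ger0_norm q1) (ger0_norm t0) (_ : r * `|S| * t ^+ 2 = (r * t) * (t * `|S|)); last by ring.
  by rewrite ler_wpM2r// mulr_ge0.
have b5 : `|(1 - q - r * t) * (v p - V)| <= r ^+ 2 * `|v p - V| * t ^+ 2.
  rewrite normrM (_ : r ^+ 2 * `|v p - V| * t ^+ 2 = (r * t) ^+ 2 * `|v p - V|); last by ring.
  by rewrite ler_wpM2r.
rewrite (_ : E - V - _ = (E - (q * E1 + (1 - q) * E3)) + (1 - q) * (E3 - v p) +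
   q * ((E1 - V) - (Q * (E2 - V) + t * S)) - (1 - q) * (t * S) + (1 - q - r * t) * (v p - V)); last by ring.
set x1 := E - (q * E1 + (1 - q) * E3) in b1 *.
set x2 := (1 - q) * (E3 - v p) in b2 *.
set x3 := q * ((E1 - V) - (Q * (E2 - V) + t * S)) in b3 *.
set x4 := (1 - q) * (t * S) in b4 *.
set x5 := (1 - q - r * t) * (v p - V) in b5 *.
by move: b1 b2 b3 b4 b5; rewrite !ler_norml; lra.
Qed.

End Expectation.

(** * The mean slope *)

Section Main.
Context d (T : measurableType d) (R : realType) (P : probability T R).
Variables (m n k : nat) (Z : {set 'I_m * 'I_n}).
Variable X : 'I_m * 'I_n -> T -> R.
Variables (wR : 'I_m -> R) (wC : 'I_n -> R).
Hypotheses (wR_gt0 : forall i, 0 < wR i) (wC_gt0 : forall j, 0 < wC j).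
Hypotheses (k_gt0 : (0 < k)%N) (k_le : (k <= minn m n)%N).

Let rate (p : 'I_m * 'I_n) : R := wR p.1 * wC p.2.

Hypothesis mX : forall p, measurable_fun setT (X p).
Hypothesis X_ge0 : forall p w, 0 <= X p w.
Hypothesis XZ : forall p w, p \in Z -> X p w = 0.
Hypothesis X_indep : forall (J : {set 'I_m * 'I_n}) (B : 'I_m * 'I_n -> set R),
  J \subset (~: Z)%SET -> (forall p, measurable (B p)) ->
  P (\bigcap_(p in [set` J]) X p @^-1` B p)%classic = (\prod_(p in J) P (X p @^-1` B p)%classic)%E.
Hypothesis expX : forall p, p \notin Z -> forall t, 0 <= t ->
  P [set w | t < X p w]%classic = (expR (- (rate p * t)))%:E.

Let rate_gt0 p (_ : p \notin Z) : 0 < rate p. Proof. by rewrite /rate mulr_gt0. Qed.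

Implicit Types (A B : 'M[R]_(m, n)) (H : {set 'I_m}) (F : fileset m n).

Local Notation Ex := (expect P X).
Local Notation slp := (slope k wC).

Variable V : {set 'I_m} -> R.
Hypothesis V_value : row_value k Z wR V.

Definition fused_slope H A : R := Ex (fun B => slp (fuse H A B)).

Let Ls := slope_lip_const wC.

Lemma nice_fused H A : nonneg_on H A -> nice Ls (fun B => slp (fuse H A B)).
Proof. by move=> A0; apply: nice_fuse => //; apply: nice_slope. Qed.

Lemma fuse_zero_set H A B p : (forall q, q \in Z -> B q.1 q.2 = 0) ->
  p \in zero_set Z H A -> fuse H A B p.1 p.2 = 0.
Proof. by move=> BZ; rewrite inE mxE; case: ifP => _; [move/eqP|move/BZ]. Qed.

(** The cover witnessing [explored] contains [H], so it has at least k files; then k zeros form an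
    assignment and all the minima vanish. *)
Lemma fused_slope_not_coverable s H A : nonneg_on H A -> explored Z s H A ->
  ~~ coverable k Z H -> fused_slope H A = 0.
Proof.
move=> A0 [N [F [[sN aN cN] [cF HF nF]]]] nc.
have ks : (k <= s)%N.
  rewrite leqNgt; apply: contra nc => sk; apply/existsP; exists F.
  by rewrite cF HF (leq_ltn_trans nF).
rewrite -(expect_cst P X 0); apply: (expect_eq P X_ge0 XZ) => B B0 BZ.
apply: (slope_eq0 k_le _ (fuse_ge0 A0 B0) aN); first by rewrite cN.
by move=> p /(fintype.subsetP sN) /fuse_zero_set; apply.
Qed.

Definition row_override (i : 'I_m) (y : 'I_n -> R) A : 'M[R]_(m, n) :=
  \matrix_(i', j) if i' == i then y j else A i' j.

Lemma fused_slope_set_row H A i v : nonneg_on H A -> i \notin H ->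
  (forall y : 'I_n -> R, (forall j, 0 <= y j) -> (forall j, (i, j) \in Z -> y j = 0) ->
     fused_slope (i |: H) (row_override i y A) = v) -> fused_slope H A = v.
Proof.
move=> A0 iH h.
apply: (expect_set_row mX X_ge0 XZ X_indep rate_gt0 expX (i := i) (nice_fused A0)) => y y0 yZ.
rewrite -(h y y0 yZ); congr expect; apply/funext => B; congr (slope _ _ _).
apply/matrixP => i' j; rewrite !mxE !inE mem_enum andbT.
by have [->|_] := eqVneq i' i; rewrite /= ?(negbTE iH).
Qed.

Lemma nonneg_override H A i (y : 'I_n -> R) : nonneg_on H A -> (forall j, 0 <= y j) ->
  nonneg_on (i |: H) (row_override i y A).
Proof.
by move=> A0 y0 i' j; rewrite !inE mxE; case: eqVneq => //= _; apply: A0.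
Qed.

Section Induction.
Variable H : {set 'I_m}.
Hypothesis IH : forall i A s, i \notin H -> nonneg_on (i |: H) A -> explored Z s (i |: H) A ->
  fused_slope (i |: H) A = V (i |: H)%SET.

(** Revealing a row [i] of the larger cover [F] preserves the invariant, so the mean is V(H + i).
    This equals V(H) by [row_value_closure]: joining [F] to a cover [G] whose rows contain [H] does
    not increase the number of files, as the opposite join has at least [s]. *)
Lemma fused_slope_extend s A : nonneg_on H A -> explored Z s H A -> row_extendable Z s H ->
  fused_slope H A = V H.
Proof.
move=> A0 stA /existsP[F /and3P[cF HF nF]].
have [HF' [i iF iH]] := properP HF.
apply: (fused_slope_set_row A0 iH) => y y0 yZ.
have stN : explored Z s (i |: H) (row_override i y A).
  apply: (exploredU1 stA (And3 cF HF' nF) iF iH).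
    by move=> i' j i'H; rewrite mxE; case: eqVneq => // e; rewrite e (negbTE iH) in i'H.
  by move=> j ijZ; rewrite mxE eqxx yZ.
rewrite (IH iH (nonneg_override A0 y0) stN).
apply: (row_value_closure wR_gt0 V_value (H := H)) => // L HL /existsP[G /and3P[cG LG nG]].
apply/existsP; exists (row_join G F); apply/and3P; split.
- exact: covers_row_join.
- rewrite finset.subUset finset.sub1set /= inE iF orbT /=.
  by apply: fintype.subset_trans LG _; apply: finset.subsetUl.
- have cc : covers_zeros (zero_set Z H A) (col_join G F).
    apply: covers_zero_set; first exact: covers_col_join.
    by rewrite /= finset.subsetI HF' (fintype.subset_trans HL).
  have := explored_nfiles stA cc => h.
  have e := nfiles_join G F.
  by rewrite -(ltn_add2r s); apply: leq_ltn_trans (leq_add (leqnn _) h) _; rewrite e -addSn leq_add.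
Qed.

Section Flow.
Variables (s : nat) (A : 'M[R]_(m, n)) (F : fileset m n).
Hypotheses (A0 : nonneg_on H A) (stA : explored Z s H A).
Hypotheses (nex : ~~ row_extendable Z s H) (maxF : max_cover Z s H A F).
Hypothesis cH : coverable k Z H.

(* Along the flow the free entries, which all have excess 1, remain exponential
   by lack of memory, and the optimal cover [F] stays optimal. *)
Definition flow (t : R) : 'M[R]_(m, n) := \matrix_(i, j) (A i j - t * excess R F (i, j)).

Let FH : F.1 \subset H. Proof. exact (max_cover_rows stA maxF nex). Qed.

Let sk : (s < k)%N.
Proof.
case/existsP: cH => G /and3P[cG HG nG]; apply: leq_ltn_trans nG.
exact: explored_nfiles stA (covers_zero_set A cG HG).
Qed.

Lemma flow0 : flow 0 = A.
Proof. by apply/matrixP => i j; rewrite mxE mul0r subr0. Qed.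

Lemma excess_covered_once p : covered_once F p -> excess R F p = 0.
Proof.
by rewrite /covered_once /excess; case: (p.1 \in F.1); case: (p.2 \in F.2) => //= _; ring.
Qed.

Lemma flow_single_zeros t p : p \in single_zeros Z H A F -> p.1 \in H -> flow t p.1 p.2 = 0.
Proof.
rewrite !inE => /andP[zp op] pH; rewrite mxE -surjective_pairing excess_covered_once// mulr0 subr0.
by move: zp; rewrite pH => /eqP.
Qed.

Definition free_positions : seq ('I_m * 'I_n) :=
  [seq p <- enum {: 'I_m * 'I_n} | (p.1 \notin H) && (p.2 \notin F.2)].

Lemma mem_free_positions p : (p \in free_positions) = (p.1 \notin H) && (p.2 \notin F.2).
Proof. by rewrite mem_filter mem_enum andbT. Qed.

Lemma free_positions_Z : {in free_positions, forall p, p \notin Z}.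
Proof.
move=> p; rewrite mem_free_positions => /andP[p1 p2]; apply/negP => pZ.
have [/coversP cF _ _] := maxF.
have := cF p; rewrite inE (negbTE p1) => /(_ pZ); rewrite (negbTE p2) orbF => pF.
by move/fintype.subsetP: FH => /(_ _ pF); rewrite (negbTE p1).
Qed.

(** Outside [H] the excess is 1 at the free positions and 0 in the columns of [F], because the rows
    of [F] lie in [H]. Raising the free entries by [dt] at time [t] is thus a shift along [F] of the
    matrix at time [t + dt], and [slope_shift] applies with matchings made of single zeros. *)
Lemma slope_flow t dt B : 0 <= dt -> nonneg_on H (flow t) -> nonneg_on H (flow (t + dt)) ->
  (forall i j, 0 <= B i j) -> (forall p, p \in Z -> B p.1 p.2 = 0) ->
  slp (fuse H (flow t) (shift_on free_positions dt + B)) =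
  slp (fuse H (flow (t + dt)) B) + dt * weight wC (~: F.2).
Proof.
move=> dt0 f0 f1 B0 BZ.
have S0 i j : 0 <= (shift_on free_positions dt + B) i j.
  by rewrite !mxE; case: ifP => _; rewrite ?add0r// addr_ge0.
have [N [sN aN cN]] := single_zeros_matching stA maxF.
have [cF nF _] := maxF.
have zB p : p \in single_zeros Z H A F -> fuse H (flow (t + dt)) B p.1 p.2 = 0.
  move=> ps; rewrite mxE; case: (boolP (p.1 \in H)) => pH.
    exact: flow_single_zeros.
  by apply: BZ; move: ps; rewrite !inE (negbTE pH) => /andP[].
have sub : single_zeros Z H A F \subset zero_set Z H A.
  by apply/fintype.subsetP => p; rewrite inE => /andP[].
have /choice[Nj hNj] := single_zeros_avoid stA maxF.
apply: (slope_shift k_gt0 k_le wC (N := N) (Nj := Nj) (F := F) dt0) => //.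
- exact: fuse_ge0.
- exact: fuse_ge0.
- by move=> p /(fintype.subsetP sN); apply: zB.
- by apply: coversS cF; apply: fintype.subset_trans sN sub.
- by rewrite cN.
- move=> j; have [a1 a2 a3 a4] := hNj j; split=> //.
    by move=> p /(fintype.subsetP a2); apply: zB.
  by apply: coversS cF; apply: fintype.subset_trans a2 sub.
- move=> -[i j]; rewrite !mxE /=; case: (boolP (i \in H)) => iH; first by ring.
  rewrite mem_free_positions /= iH /= /excess /=.
  have -> : i \in F.1 = false by apply/negbTE; apply: contra iH; apply: (fintype.subsetP FH).
  by case: (j \in F.2) => /=; ring.
- by rewrite nF.
Qed.

Definition total_rate : R := \sum_(p <- free_positions) rate p.

Lemma big_free_positions (f : 'I_m -> 'I_n -> R) :
  \sum_(p <- free_positions) f p.1 p.2 = \sum_(i in ~: H) \sum_(j in ~: F.2) f i j.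
Proof.
rewrite /free_positions big_filter big_enum_cond/= pair_big/=.
by apply: eq_bigl => p; rewrite !inE.
Qed.

Lemma total_rateE : total_rate = weight wR (~: H) * weight wC (~: F.2).
Proof.
rewrite /total_rate /rate (big_free_positions (fun i j => wR i * wC j)) /weight mulr_suml.
by apply: eq_bigr => i _; rewrite mulr_sumr.
Qed.

Lemma card_cover_lt : (#|H| < m)%N /\ (#|F.2| < n)%N.
Proof.
have [cF nF _] := maxF; have le := leq_trans sk k_le.
split; last first.
  apply: leq_trans (_ : s < n)%N; last by apply: leq_trans le (geq_minr _ _).
  by rewrite ltnS -nF /nfiles leq_addl.
case/existsP: cH => G /and3P[_ HG nG].
apply: leq_trans (leq_trans k_le (geq_minl _ _)); apply: leq_ltn_trans nG.
by apply: leq_trans (subset_leq_card HG) _; rewrite /nfiles leq_addr.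
Qed.

Lemma weight_gt0 (I : finType) (w : I -> R) (S : {set I}) : (forall i, 0 < w i) ->
  (0 < #|S|)%N -> 0 < weight w S.
Proof.
move=> w0 /card_gt0P[i iS]; rewrite /weight (big_setD1 i)//= ltr_wpDr//.
by apply: sumr_ge0 => l _; apply: ltW.
Qed.

Lemma weights_gt0 : 0 < weight wR (~: H) /\ 0 < weight wC (~: F.2).
Proof.
have [h1 h2] := card_cover_lt.
by split; apply: weight_gt0 => //; rewrite cardsCs finset.setCK card_ord subn_gt0.
Qed.

(** A free entry at 0 reveals its row: whatever the other entries of the row, [explored_hit]
    restores the invariant, and the induction hypothesis always returns the same mean. *)
Lemma hit_value t p : nonneg_on H (flow t) -> p \in free_positions ->
  Ex (fun B => slp (fuse H (flow t) (upd B p 0))) = V (p.1 |: H)%SET.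
Proof.
case: p => i j ft0; rewrite mem_free_positions /= => /andP[iH jF].
have nF := nice_upd (i, j) (lexx 0) (nice_fused ft0).
apply: (expect_set_row mX X_ge0 XZ X_indep rate_gt0 expX (i := i) nF) => y y0 yZ.
pose y' l := if l == j then 0 else y l.
have y'0 l : 0 <= y' l by rewrite /y'; case: ifP.
have [s' st'] : exists s', explored Z s' (i |: H) (row_override i y' (flow t)).
  apply: (explored_hit stA maxF nex _ iH jF) => [p ps pH||l ilZ].
  - rewrite mxE; case: eqVneq => [e|_]; first by rewrite -e pH in iH.
    exact: flow_single_zeros.
  - by rewrite mxE eqxx /y' eqxx.
  - by rewrite mxE eqxx /y'; case: ifP => // _; apply: yZ.
rewrite -(IH iH (nonneg_override ft0 y'0) st').
congr expect; apply/funext => B; congr (slope _ _ _).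
apply/matrixP => i' j'; rewrite !mxE !inE mem_enum andbT xpair_eqE /y'.
have [->|_] /= := eqVneq i' i; first by rewrite (negbTE iH).
by [].
Qed.

Definition gap (t : R) : R := fused_slope H (flow t) - V H.

Lemma shift_on_ge0 (l : seq ('I_m * 'I_n)) (t : R) : 0 <= t ->
  forall i j, 0 <= (shift_on l t : 'M[R]_(m, n)) i j.
Proof. by move=> t0 i j; rewrite mxE; case: ifP. Qed.

Lemma fused_slope_flow t dt : 0 <= dt -> nonneg_on H (flow t) -> nonneg_on H (flow (t + dt)) ->
  Ex (fun B => slp (fuse H (flow t) (shift_on free_positions dt + B))) =
  fused_slope H (flow (t + dt)) + dt * weight wC (~: F.2).
Proof.
move=> dt0 f0 f1; rewrite /fused_slope -(expect_addc mX X_ge0 XZ rate_gt0 expX _ (nice_fused f1)).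
by apply: (expect_eq P X_ge0 XZ) => B B0 BZ; apply: slope_flow.
Qed.

(** A hit in row [i] changes the value from V(H) to V(H + i). By the recursion of [V] the hits
    contribute -c per unit of time, which cancels the drift c of the slope. There remains
    exponential decay at the total rate, up to a second-order error that is uniform in [t]. *)
Lemma gap_step : exists C, forall t dt, 0 <= dt ->
  nonneg_on H (flow t) -> nonneg_on H (flow (t + dt)) ->
  `|gap t - expR (- (total_rate * dt)) * gap (t + dt)| <= C * dt ^+ 2.
Proof.
have L0 : 0 <= Ls by rewrite /Ls mulr_ge0// sumr_ge0.
have us : uniq free_positions by rewrite filter_uniq// enum_uniq.
have [C C0 hC] := expect_multi_step mX X_ge0 XZ X_indep rate_gt0 expX
  (fun p => V (p.1 |: H)%SET) (V H) L0 us free_positions_Z (lexx 0).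
pose c := weight wC (~: F.2).
have [wH0 c0] := weights_gt0; rewrite -/c in c0.
(* The drift enters as q dt c rather than dt c; the second summand pays for (1 - q) dt c. *)
exists (C + total_rate * c) => t dt dt0 f0 f1.
have := hC _ dt (nice_fused f0) dt0.
rewrite (fused_slope_flow dt0 f0 f1) -/c -/total_rate.
have -> : \sum_(p <- free_positions) rate p * (V (p.1 |: H)%SET - V H) = - c.
  rewrite (big_free_positions (fun i j => wR i * wC j * (V (i |: H)%SET - V H))).
  rewrite (_ : \sum_(i in ~: H) _ = c * \sum_(i in ~: H) (wR i * V (i |: H)%SET - wR i * V H)); last first.
    rewrite mulr_sumr; apply: eq_bigr => i _; rewrite /c /weight mulr_suml.
    by apply: eq_bigr => j _; ring.
  rewrite sumrB -mulr_suml -/(weight wR (~: H)) (V_value.2 _ cH); ring.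
set q := expR _ => h.
have {h} : `|fused_slope H (flow t) - V H - (q * (fused_slope H (flow (t + dt)) + dt * c - V H) + dt * - c)| <= C * dt ^+ 2.
  by apply: h => p ps; rewrite hit_value// subrr normr0 mul0r.
have lam0 : 0 <= total_rate * dt by rewrite mulr_ge0// total_rateE mulr_ge0// ltW.
have [/andP[q1 q2] _] := expRN_bounds lam0; rewrite -/q in q1 q2.
have h2 : 0 <= (1 - q) * (dt * c) <= total_rate * c * dt ^+ 2.
  rewrite mulr_ge0//=; last by rewrite mulr_ge0// ltW.
  rewrite (_ : total_rate * c * dt ^+ 2 = total_rate * dt * (dt * c)); last by ring.
  by rewrite ler_wpM2r// mulr_ge0// ltW.
rewrite /gap; set a := fused_slope H (flow t); set b := fused_slope H _.
rewrite (_ : a - V H - (q * (b + dt * c - V H) + dt * - c) =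
  (a - V H - q * (b - V H)) + (1 - q) * (dt * c)); last by ring.
move: h2; set x := (1 - q) * (dt * c); set y := _ - q * _.
by rewrite mulrDl !ler_norml; lra.
Qed.

(** A known entry decreases only where its excess is 1, outside all files of [F]. *)
Lemma flow_nonneg t : 0 <= t ->
  (forall i j, i \in H -> i \notin F.1 -> j \notin F.2 -> t <= A i j) -> nonneg_on H (flow t).
Proof.
move=> t0 h i j iH; have Aij := A0 j iH; rewrite mxE /excess /=.
case: (boolP (i \in F.1)) => iF /=; case: (boolP (j \in F.2)) => jF /=.
- by rewrite (_ : A i j - _ = A i j + t); [rewrite addr_ge0|ring].
- by rewrite (_ : A i j - _ = A i j); [|ring].
- by rewrite (_ : A i j - _ = A i j); [|ring].
- by rewrite (_ : A i j - _ = A i j - t); [rewrite subr_ge0 h|ring].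
Qed.

Lemma gap0_le T0 : 0 <= T0 ->
  (forall i j, i \in H -> i \notin F.1 -> j \notin F.2 -> T0 <= A i j) ->
  `|gap 0| <= expR (- (total_rate * T0)) * `|gap T0|.
Proof.
move=> T00 h; have [C hC] := gap_step; have [w1 w2] := weights_gt0.
apply: (@exp_contraction _ gap total_rate C T0) => //; first by rewrite total_rateE mulr_ge0// ltW.
move=> t dt t0 dt0 le; apply: hC => //.
  by apply: flow_nonneg => // i j iH iF jF; apply: le_trans (h i j iH iF jF); lra.
by apply: flow_nonneg; [exact: addr_ge0|move=> i j iH iF jF; apply: le_trans (h i j iH iF jF)].
Qed.

Lemma gap0_fused_slope : gap 0 = 0 -> fused_slope H A = V H.
Proof. by rewrite /gap flow0 => /eqP; rewrite subr_eq0 => /eqP. Qed.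

(** The flow runs until [T0], the least known entry outside the files of [F]. By then that entry is
    0 and every maximal cover has fewer columns, so [inner] makes the gap vanish at [T0]; the
    contraction carries this back to time 0. *)
Lemma flow_hits_zero i0 j0 : i0 \in H -> i0 \notin F.1 -> j0 \notin F.2 ->
  (forall A', nonneg_on H A' -> explored Z s H A' ->
     (forall F', max_cover Z s H A' F' -> (#|F'.2| < #|F.2|)%N) -> fused_slope H A' = V H) ->
  fused_slope H A = V H.
Proof.
move=> i0H i0F j0F inner; apply: gap0_fused_slope.
pose Q (p : 'I_m * 'I_n) := [&& p.1 \in H, p.1 \notin F.1 & p.2 \notin F.2].
have Q0 : Q (i0, j0) by rewrite /Q i0H i0F j0F.
case: (@Order.TotalTheory.arg_minP _ _ _ (i0, j0) Q (fun p => A p.1 p.2) Q0).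
move=> [i1 j1] /and3P[/= i1H i1F j1F] hmin.
pose T0 := A i1 j1; have T00 : 0 <= T0 by apply: A0.
have h i j : i \in H -> i \notin F.1 -> j \notin F.2 -> T0 <= A i j.
  by move=> iH iF jF; apply: (hmin (i, j)); rewrite /Q /= iH iF jF.
have z1 : flow T0 i1 j1 = 0.
  by rewrite mxE /excess /= (negbTE i1F) (negbTE j1F) /= /T0; ring.
have g0 : gap T0 = 0.
  have zf := @flow_single_zeros T0.
  rewrite /gap inner ?subrr//; first exact: flow_nonneg.
    exact (explored_shift stA maxF zf).
  move=> F' [cF' nF' _].
  apply: (explored_new_zero stA maxF zf i1H i1F j1F z1 cF').
  by rewrite nF'.
by apply/eqP; rewrite -normr_le0; apply: le_trans (gap0_le T00 h) _; rewrite g0 normr0 mulr0.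
Qed.

(** No known entry decreases, so the contraction holds over every time span, while the Lipschitz
    bound and the drift let the gap grow at most linearly. *)
Lemma flow_unbounded : H \subset F.1 -> fused_slope H A = V H.
Proof.
move=> HF; apply: gap0_fused_slope.
have h (t : R) i j : i \in H -> i \notin F.1 -> j \notin F.2 -> t <= A i j.
  by move=> iH; rewrite (fintype.subsetP HF _ iH).
have [w1 w2] := weights_gt0.
have lam0 : 0 < total_rate by rewrite total_rateE mulr_gt0.
have L0 : 0 <= Ls by rewrite /Ls mulr_ge0// sumr_ge0.
(* [K] is the number of entries, so a shift by [t] moves the matrix by at most [K * t] in
   [dist1]. *)
pose K : R := \sum_(i < m) \sum_(j < n) 1.
have K0 : 0 <= K by do 2 (apply: sumr_ge0 => ? _).
pose c := weight wC (~: F.2).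
have nf t : 0 <= t -> nonneg_on H (flow t) by move=> t0; apply: flow_nonneg => //; apply: h.
have f0 := nf 0 (lexx 0).
apply/eqP; rewrite -normr_eq0; apply/eqP.
apply: (@exp_beats_linear _ _ _ (`|fused_slope H (flow 0)| + `|V H|) (Ls * K + c) lam0) => //.
  by apply: addr_ge0; [apply: mulr_ge0|apply: ltW w2].
move=> t t0; apply: le_trans (gap0_le t0 (h t)) _; rewrite ler_wpM2l ?expR_ge0//.
have ft : nonneg_on H (flow (0 + t)) by rewrite add0r; apply: nf.
have e := fused_slope_flow t0 f0 ft.
have nG := nice_fused f0; have nS := nice_shift (shift_on_ge0 free_positions t0) nG.
have : `|Ex (fun B => slp (fuse H (flow 0) (shift_on free_positions t + B))) - fused_slope H (flow 0)| <= Ls * (K * t).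
  apply: (expect_close mX X_ge0 XZ rate_gt0 expX nS nG) => B B0; have [_ _ _ lG] := nG.
  apply: le_trans (lG _ _) _; rewrite ler_wpM2l// /K mulr_suml; apply: ler_sum => i _.
  rewrite mulr_suml; apply: ler_sum => j _; rewrite !mxE addrK mul1r.
  by case: ifP => _; rewrite ?normr0// ger0_norm.
rewrite e add0r -/c /gap.
have tc : 0 <= t * c by rewrite mulr_ge0// ltW.
move: (fused_slope H (flow t)) (fused_slope H (flow 0)) (V H) => x y z.
have := ler_norm y; have := ler_norm (- y); have := ler_norm z; have := ler_norm (- z).
by rewrite !normrN => h1 h2 h3 h4; rewrite !ler_norml; lra.
Qed.

End Flow.

(** The inner induction, on the number of columns of the chosen cover; the outer one, on the rows
    not yet revealed, enters through [IH]. *)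
Lemma fused_slope_step s A : nonneg_on H A -> explored Z s H A -> fused_slope H A = V H.
Proof.
move=> A0 stA; have [cH|cH] := boolP (coverable k Z H); last first.
  by rewrite (fused_slope_not_coverable A0 stA cH) (V_value.1 _ cH).
have [ex|nex] := boolP (row_extendable Z s H); first exact (fused_slope_extend A0 stA ex).
have [F maxF] := max_cover_ex stA.
have [b] := ubnP #|F.2|; elim: b => // b IHb in A F A0 stA maxF * => /ltnSE leb.
have [HF|/fintype.subsetPn[i iH iF]] := boolP (H \subset F.1).
  exact (flow_unbounded A0 stA nex maxF cH HF).
have [_ hn] := card_cover_lt stA maxF cH.
have /card_gt0P[j] : (0 < #|~: F.2|)%N by rewrite cardsCs finset.setCK card_ord subn_gt0.
rewrite inE => jF; apply: (flow_hits_zero A0 stA nex maxF cH iH iF jF) => A' A'0 stA' lt.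
have [F' maxF'] := max_cover_ex stA'.
by apply: (IHb A' F') => //; apply: leq_trans (lt F' maxF') leb.
Qed.

End Induction.

Theorem fused_slope_explored s H A : nonneg_on H A -> explored Z s H A -> fused_slope H A = V H.
Proof.
have [r] := ubnP #|~: H|; elim: r H A s => // r IHr H A s /ltnSE leH.
apply: fused_slope_step => i A' s' iH; apply: IHr.
apply: leq_trans leH; apply: proper_card; apply/properP; split.
  by rewrite finset.setCS finset.subsetUr.
by exists i; rewrite !inE ?iH// eqxx.
Qed.

Corollary expect_slope : Ex slp = V finset.set0.
Proof.
have [s st] := explored_init Z (H := finset.set0) (0 : 'M[R]_(m, n)) erefl.
rewrite -(fused_slope_explored (A := 0) _ st); last by move=> i j; rewrite inE.
by congr expect; apply/funext => B; congr (slope _ _ _); apply/matrixP => i j; rewrite mxE inE.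
Qed.

End Main.

(** * The Möbius side *)

Section MobiusDual.
Variables (d : Order.disp_t) (T : finPOrderType d).
Implicit Types x y z : T.

Lemma mobius_sum x y : \sum_(z : T | (x <= z <= y)%O) mobius x z = (x == y)%:R.
Proof.
have [<-|nxy] := eqVneq x y.
  rewrite (bigD1 x) ?lexx//= big1 ?addr0; first by rewrite mobiusE eqxx.
  move=> z /andP[/andP[xz zx]]; suff -> : z = x by rewrite eqxx.
  by apply: le_anti; rewrite zx.
have [xy|nle] := boolP (x <= y)%O; last first.
  by rewrite big1// => z /andP[xz zy]; rewrite (le_trans xz zy) in nle.
have ltxy : (x < y)%O by rewrite lt_neqAle nxy.
rewrite (bigD1 y) ?xy ?lexx//= mobiusE (negbTE nxy) ltxy addrC.
rewrite (eq_bigl (fun z => (x <= z < y)%O)) ?subrr// => z.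
by rewrite lt_neqAle -andbA; congr (_ && _); rewrite andbC.
Qed.

Lemma mobius_not_le x y : ~~ (x <= y)%O -> mobius x y = 0.
Proof.
move=> nle; rewrite mobiusE; case: eqVneq => [e|_]; first by rewrite e lexx in nle.
by rewrite lt_neqAle (negbTE nle) andbF.
Qed.

(** [mobius] recurs on its second argument, whereas the theorem fixes that argument at the top. A
    left inverse of a square matrix is also a right inverse, and this exchanges the two roles. *)
Lemma mobius_sum_dual x y : \sum_(z : T | (x <= z <= y)%O) mobius z y = (x == y)%:R.
Proof.
pose M : 'M[int]_#|T| := \matrix_(i, j) mobius (enum_val i) (enum_val j).
pose E : 'M[int]_#|T| := \matrix_(i, j) (enum_val i <= enum_val j)%O%:R.
have ME : M *m E = 1%:M.
  apply/matrixP => i j; rewrite !mxE.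
  rewrite -(inj_eq enum_val_inj) -mobius_sum [RHS]big_mkcond.
  rewrite [RHS](reindex _ (onW_bij _ (@enum_val_bij T))); apply: eq_bigr => l _; rewrite !mxE.
  have [h|h] := boolP (enum_val i <= enum_val l)%O; last by rewrite mobius_not_le// mul0r.
  by case: (_ <= _)%O; rewrite ?mulr1 ?mulr0.
have /matrixP/(_ (enum_rank x) (enum_rank y)) := mulmx1C ME.
rewrite !mxE (inj_eq enum_rank_inj) => <-.
rewrite big_mkcond (reindex _ (onW_bij _ (@enum_val_bij T))); apply: eq_bigr => l _.
rewrite !mxE !enum_rankK.
have [h|h] := boolP (enum_val l <= y)%O; last by rewrite andbF mobius_not_le// mulr0.
by rewrite andbT; case: (_ <= _)%O; rewrite ?mul1r ?mul0r.
Qed.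

End MobiusDual.

(** * The Möbius coefficients and the sums formed with them *)

Section Coefficients.
Variables (m n k : nat).
Hypotheses (k_gt0 : (0 < k)%N) (k_le : (k <= minn m n)%N).
Implicit Types (Z : {set 'I_m * 'I_n}) (F G A : fileset m n).

(* Extended by 0 to all filesets, so that sums for different sets of zeros range
   over the same index set. *)
Definition cover_coef Z G : int :=
  if insub G is Some F then - mobius (Some F : Jk_hat Z k) \top%O else 0.

Lemma cover_coef_notin Z G : ~~ partial_cover Z k.-1 G -> cover_coef Z G = 0.
Proof. by move=> h; rewrite /cover_coef insubN. Qed.

Lemma sum_Jk (R : zmodType) Z (h : fileset m n -> R) (P : pred (fileset m n)) :
  (forall G, ~~ partial_cover Z k.-1 G -> h G = 0) ->
  \sum_(G | P G) h G = \sum_(F : Jk Z k | P (val F)) h (val F).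
Proof.
move=> h0; rewrite (bigID (partial_cover Z k.-1)) /= [X in _ + X]big1 ?addr0; last first.
  by move=> G /andP[_ /h0].
rewrite (reindex_omap (val : Jk Z k -> fileset m n) insub) /=; last first.
  by move=> G /andP[_ pG]; rewrite insubT.
apply: eq_bigl => F; rewrite (valP F) andbT valK eqxx andbT //.
Qed.

Lemma partial_coverS Z r F G : (F <= G)%O -> partial_cover Z r G -> partial_cover Z r F.
Proof.
move=> FG /existsP[G' /andP[c l]]; apply/existsP; exists G'; rewrite c.
exact: le_trans l.
Qed.

(** The dual Möbius relation on the interval from [A] to the top, with the term 1 of the top moved
    across. Nothing above [A] is a partial cover if [A] is not. *)
Lemma cover_coef_sum Z A : \sum_(G | (A <= G)%O) cover_coef Z G = (partial_cover Z k.-1 A)%:R.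
Proof.
have [pA|pA] := boolP (partial_cover Z k.-1 A); last first.
  rewrite big1// => G AG; apply: cover_coef_notin; apply: contra pA; exact: partial_coverS.
rewrite (sum_Jk (Z := Z)); last exact: cover_coef_notin.
pose A' : Jk Z k := Sub A pA.
have := mobius_sum_dual (Some A' : Jk_hat Z k) \top%O.
rewrite (_ : (Some A' == \top%O :> Jk_hat Z k) = false)//.
rewrite (bigD1 (\top%O : Jk_hat Z k)) ?lexx ?lex1//= {1}mobiusE eqxx => /eqP.
rewrite addrC addr_eq0 => /eqP e.
rewrite [LHS](_ : _ = - \sum_(F : Jk Z k | (A <= val F)%O) mobius (Some F : Jk_hat Z k) \top%O); last first.
  by rewrite -sumrN; apply: eq_bigr => F _; rewrite /cover_coef valK.
apply/eqP; rewrite eqr_oppLR; apply/eqP; rewrite -[RHS]e.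
rewrite [RHS](reindex_omap (Some : Jk Z k -> Jk_hat Z k) id) /=.
  apply: eq_bigl => F; rewrite eqxx lex1 !andbT.
  by rewrite [X in _ = X](_ : _ = (A <= val F)%O).
by case.
Qed.

(** Coefficients for different sets of zeros are compared through their upper sums: [a A] follows
    from the values strictly above [A]. *)
Lemma coef_unique (a b : fileset m n -> int) :
  (forall A, \sum_(G | (A <= G)%O) a G = \sum_(G | (A <= G)%O) b G) -> a =1 b.
Proof.
move=> h A; have [r] := ubnP #|[pred G : fileset m n | (A <= G)%O]|.
elim: r A => // r IH A /ltnSE leA.
have := h A; rewrite (bigD1 A) ?lexx//= [RHS](bigD1 A) ?lexx//=.
rewrite (eq_bigr b); first by move/addIr.
move=> G /andP[AG GA]; apply: IH; apply: leq_trans leA; apply: proper_card; apply/properP; split.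
  by apply/fintype.subsetP => G'; rewrite !inE; apply: le_trans.
by exists A; rewrite !inE ?lexx//; apply: contra GA => GA; apply/eqP/le_anti; rewrite GA.
Qed.

Definition fill_col Z (j : 'I_n) : {set 'I_m * 'I_n} := (Z :|: [set p | p.2 == j])%SET.

Lemma km : (k.-1 < m)%N.
Proof. by rewrite prednK//; apply: leq_trans k_le (geq_minl _ _). Qed.

Lemma kn : (k.-1 < n)%N.
Proof. by rewrite prednK//; apply: leq_trans k_le (geq_minr _ _). Qed.

(** Fewer than m rows cannot cover a full column of zeros, so a (k-1)-cover must contain the column
    itself. *)
Lemma partial_cover_fill Z j A :
  partial_cover (fill_col Z j) k.-1 A = partial_cover Z k.-1 (A.1, j |: A.2)%SET.
Proof.
apply/existsP/existsP => -[G /andP[/andP[cG nG] AG]]; exists G; apply/andP; split.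
- rewrite /rcover nG andbT; apply: coversS cG; exact: finset.subsetUl.
- move: AG => /andP[AG1 AG2]; apply/andP; split=> //=.
  rewrite finset.subUset AG2 andbT finset.sub1set; apply: contraT => jG.
  have : (m <= #|G.1|)%N.
    rewrite -[X in (X <= _)%N]card_ord; apply: subset_leq_card; apply/fintype.subsetP => i _.
    by move/coversP: cG => /(_ (i, j)); rewrite !inE eqxx orbT /= (negbTE jG) orbF; apply.
  by rewrite leqNgt (leq_ltn_trans _ km)// -(eqP nG) leq_addr.
- move: AG => /andP[_]; rewrite /= finset.subUset finset.sub1set => /andP[jG _].
  rewrite /rcover nG andbT; apply/coversP => p; rewrite !inE => /orP[pZ|/eqP->].
    by move/coversP: cG; apply.
  by rewrite jG orbT.
- move: AG => /andP[AG1]; rewrite /= finset.subUset => /andP[_ AG2].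
  by apply/andP.
Qed.

Lemma cover_coef_fill Z j G :
  cover_coef (fill_col Z j) G = if j \in G.2 then cover_coef Z G else 0.
Proof.
move: G; apply: coef_unique => A; rewrite cover_coef_sum partial_cover_fill -cover_coef_sum.
rewrite [RHS]big_mkcond [LHS]big_mkcond; apply: eq_bigr => G _.
rewrite [in LHS]/Order.le/= /subfileset/= finset.subUset finset.sub1set.
rewrite [in RHS]/Order.le/= /subfileset/=.
by case: (A.1 \subset G.1); case: (A.2 \subset G.2); case: (j \in G.2).
Qed.

Lemma pad_cover Z F r : covers_zeros Z F -> (nfiles F <= r)%N -> (r <= m + n)%N ->
  exists G, rcover Z r G && (F <= G)%O.
Proof.
move=> cF nF rmn; have [b] := ubnP (r - nfiles F); elim: b F cF nF => // b IH F cF nF /ltnSE leb.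
have [e|ne] := eqVneq (nfiles F) r.
  by exists F; rewrite /rcover cF lexx andbT -e /nfiles eqxx.
have lt : (nfiles F < r)%N by rewrite ltn_neqAle ne.
have step G : (nfiles G = (nfiles F).+1)%N -> (F <= G)%O -> exists G', rcover Z r G' && (G' >= F)%O.
  move=> nG FG; have cG : covers_zeros Z G.
    apply/coversP => p pZ; move/coversP: cF => /(_ p pZ).
    by move: FG => /andP[/fintype.subsetP s1 /fintype.subsetP s2] /orP[/s1->|/s2->]//; rewrite orbT.
  have [||G' /andP[h1 h2]] := IH G cG; first by rewrite nG.
    by rewrite nG; apply: leq_trans leb; rewrite subnS; case: (r - nfiles F)%N (subn_gt0 (nfiles F) r) => //; rewrite lt.
  by exists G'; rewrite h1 (le_trans FG h2).
have [/fintype.subsetPn[i _ iF]|] := boolP (~~ (finset.setT \subset F.1)).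
  apply: (step (i |: F.1, F.2)%SET); first by rewrite /nfiles/= cardsU1 iF.
  by rewrite /Order.le/= /subfileset/= finset.subsetUr subxx.
rewrite negbK => T1.
have [/fintype.subsetPn[j _ jF]|] := boolP (~~ (finset.setT \subset F.2)).
  apply: (step (F.1, j |: F.2)%SET); first by rewrite /nfiles/= cardsU1 jF addnCA.
  by rewrite /Order.le/= /subfileset/= finset.subsetUr subxx.
rewrite negbK => T2.
have := leq_add (subset_leq_card T1) (subset_leq_card T2).
rewrite !cardsT !card_ord => h; have := leq_trans lt rmn.
by rewrite ltnNge /nfiles h.
Qed.

Lemma partial_cover_rows Z (L : {set 'I_m}) :
  partial_cover Z k.-1 (L, finset.set0) = coverable k Z L.
Proof.
apply/existsP/existsP => [[G /andP[/andP[cG /eqP nG] /andP[LG _]]]|[F /and3P[cF LF nF]]].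
  by exists G; rewrite /nfiles nG prednK// leqnn cG (LG : L \subset G.1).
have nF' : (nfiles F <= k.-1)%N by rewrite -ltnS prednK.
have [|G /andP[h1 h2]] := pad_cover cF nF'.
  by apply: leq_trans (ltnW km) (leq_addr _ _).
exists G; rewrite h1 /=; apply: le_trans h2.
by rewrite /Order.le/= /subfileset/= LF finset.sub0set.
Qed.

(** Guarantees positive weights in the denominators of all terms that count. *)
Lemma cover_coef_neq0 Z G : cover_coef Z G != 0 -> (#|G.1| < m)%N /\ (#|G.2| < n)%N.
Proof.
move=> h; have : partial_cover Z k.-1 G by apply: contraR h => /cover_coef_notin->.
move=> /existsP[G' /andP[/andP[_ /eqP e] /andP[s1 s2]]].
split.
  by apply: leq_ltn_trans (subset_leq_card s1) (leq_ltn_trans _ km); rewrite -e leq_addr.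
by apply: leq_ltn_trans (subset_leq_card s2) (leq_ltn_trans _ kn); rewrite -e leq_addl.
Qed.

Variables (R : realType) (wR : 'I_m -> R) (wC : 'I_n -> R).
Hypotheses (wR_gt0 : forall i, 0 < wR i) (wC_gt0 : forall j, 0 < wC j).

Lemma weight_setC_gt0 (I : finType) (w : I -> R) (S : {set I}) :
  (forall i, 0 < w i) -> (#|S| < #|I|)%N -> 0 < weight w (~: S).
Proof. by move=> w0 lt; apply: weight_gt0 => //; rewrite cardsCs finset.setCK subn_gt0. Qed.

Definition row_sum Z (L : {set 'I_m}) : R :=
  \sum_(G : fileset m n | L \subset G.1) (cover_coef Z G)%:~R / weight wR (~: G.1).

(** When the sum over [i] is subtracted, the term of [G] acquires the factor w_R(R - L) - w_R(G.1 -
    L) = w_R(R - G.1), which cancels its denominator. The remaining coefficients add up to 1 by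
    [cover_coef_sum]. *)
Lemma row_sum_value Z : row_value k Z wR (row_sum Z).
Proof.
split=> L.
  move=> nc; rewrite /row_sum big1// => G LG; rewrite cover_coef_notin ?mul0r//.
  apply: contra nc => pG; rewrite -partial_cover_rows; apply: partial_coverS pG.
  by rewrite /Order.le/= /subfileset/= LG finset.sub0set.
move=> cL; pose a G : R := (cover_coef Z G)%:~R / weight wR (~: G.1).
have eS : \sum_(i in ~: L) wR i * row_sum Z (i |: L)%SET =
    \sum_(G : fileset m n | L \subset G.1) (\sum_(i in G.1 :\: L) wR i) * a G.
  under eq_bigr do rewrite /row_sum big_mkcond mulr_sumr.
  rewrite exchange_big [RHS]big_mkcond; apply: eq_bigr => G _.
  case: ifP => LG; last first.
    by rewrite big1// => i _; rewrite finset.subUset LG andbF mulr0.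
  rewrite mulr_suml [RHS]big_mkcond [LHS]big_mkcond; apply: eq_bigr => i _.
  rewrite !inE finset.subUset LG andbT finset.sub1set.
  by case: (i \in L); case: (i \in G.1) => //=; rewrite mulr0.
rewrite eS {1}/row_sum mulr_sumr -[LHS](subrK (\sum_(G : fileset m n | L \subset G.1) (\sum_(i in G.1 :\: L) wR i) * a G)).
congr (_ + _); rewrite -sumrB.
rewrite [RHS](_ : _ = \sum_(G | (((L, finset.set0) : fileset m n) <= G)%O) (cover_coef Z G)%:~R); last first.
  by rewrite -rmorph_sum cover_coef_sum partial_cover_rows cL.
apply: eq_big => G; first by rewrite /Order.le/= /subfileset/= finset.sub0set andbT.
move=> LG; rewrite -/(a G) -mulrBl.
have [c0|c0] := eqVneq (cover_coef Z G) 0; first by rewrite /a c0 mul0r mulr0.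
have [h1 _] := cover_coef_neq0 c0.
have W0 : 0 < weight wR (~: G.1) by apply: weight_setC_gt0 => //; rewrite card_ord.
rewrite (_ : _ - _ = weight wR (~: G.1)); first by rewrite /a mulrCA mulfV ?mulr1// gt_eqF.
apply/eqP; rewrite subr_eq /weight (bigID (mem G.1))/= addrC; apply/eqP; congr (_ + _).
  apply: eq_bigl => i; rewrite !inE; case iG: (i \in G.1); rewrite ?andbF ?andbT//.
  by apply/negP => /(fintype.subsetP LG); rewrite iG.
by apply: eq_bigl => i; rewrite !inE.
Qed.

Definition full_sum Z : R := \sum_(G : fileset m n)
  (cover_coef Z G)%:~R / (weight wR (~: G.1) * weight wC (~: G.2)).

Lemma full_sum_Jk Z : full_sum Z = \sum_(F : Jk Z k)
  (- mobius (Some F : Jk_hat Z k) \top%O)%:~R /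
     (weight wR (~: (val F).1) * weight wC (~: (val F).2)).
Proof.
rewrite /full_sum (sum_Jk (Z := Z) predT); last first.
  by move=> G /cover_coef_notin->; rewrite mul0r.
by apply: eq_bigr => F _; rewrite /cover_coef valK.
Qed.

(** Filling column [j] keeps the coefficients with [j] in [G.2], so the difference retains those
    with [j] outside. Summed over [j] the weights give w_C(C - G.2), which cancels the column
    factor. *)
Lemma full_sum_rec Z :
  \sum_j wC j * (full_sum Z - full_sum (fill_col Z j)) = row_sum Z finset.set0.
Proof.
under eq_bigr do rewrite /full_sum -sumrB mulr_sumr.
rewrite exchange_big /row_sum [RHS]big_mkcond; apply: eq_bigr => G _; rewrite finset.sub0set.
have [c0|c0] := eqVneq (cover_coef Z G) 0.
  rewrite c0 mulr0z [RHS]mul0r big1// => j _; rewrite cover_coef_fill c0 if_same mulr0z !mul0r subrr mulr0//.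
have [h1 h2] := cover_coef_neq0 c0.
have W0 : 0 < weight wR (~: G.1) by apply: weight_setC_gt0 => //; rewrite card_ord.
have W1 : 0 < weight wC (~: G.2) by apply: weight_setC_gt0 => //; rewrite card_ord.
rewrite (eq_bigr (fun j => (if j \in ~: G.2 then wC j else 0) *
   ((cover_coef Z G)%:~R / (weight wR (~: G.1) * weight wC (~: G.2))))); last first.
  move=> j _; rewrite cover_coef_fill inE; case: (j \in G.2) => /=.
    by rewrite subrr mulr0 mul0r.
  by rewrite mul0r subr0.
rewrite -mulr_suml -big_mkcond -/(weight wC (~: G.2)).
by field; rewrite !gt_eqF.
Qed.

(** k - 1 files miss some row and some column, hence the position where these cross. *)
Lemma full_sum_setT : full_sum finset.setT = 0.
Proof.
rewrite /full_sum big1// => G _; rewrite cover_coef_notin ?mul0r//.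
apply/existsP => -[G' /andP[/andP[cG /eqP nG] _]].
have [i iG] : exists i, i \notin G'.1.
  apply/existsP; rewrite -negb_forall; apply/negP => /forallP h.
  have : (m <= #|G'.1|)%N.
    by rewrite -[X in (X <= _)%N]card_ord; apply: subset_leq_card; apply/fintype.subsetP => i _.
  by rewrite leqNgt (leq_ltn_trans _ km)// -nG leq_addr.
have : (n <= #|G'.2|)%N.
  rewrite -[X in (X <= _)%N]card_ord; apply: subset_leq_card; apply/fintype.subsetP => j _.
  by move/coversP: cG => /(_ (i, j)); rewrite inE /= (negbTE iG) /=; apply.
by rewrite leqNgt (leq_ltn_trans _ kn)// -nG leq_addl.
Qed.

End Coefficients.

(** * The recursion on the set of zeros *)

Section ZeroedMatrix.
Context (d : measure_display) (T : measurableType d) (R : realType) (P : probability T R).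
Variables (m n k : nat) (wR : 'I_m -> R) (wC : 'I_n -> R) (Z : {set 'I_m * 'I_n}).
Variable M : 'I_m -> 'I_n -> {RV P >-> R}.
Hypotheses (wR_gt0 : forall i, 0 < wR i) (wC_gt0 : forall j, 0 < wC j).
Hypothesis MP : standard_matrix wR wC Z M.
Hypotheses (k_gt0 : (0 < k)%N) (k_le : (k <= minn m n)%N).

Implicit Types Y : {set 'I_m * 'I_n}.

Let rate (p : 'I_m * 'I_n) : R := wR p.1 * wC p.2.

(* The truncation at 0 only changes a null set; it makes the entries
   nonnegative everywhere. *)
Definition zeroed Y (p : 'I_m * 'I_n) (w : T) : R :=
  if p \in Y then 0 else Num.max 0 (M p.1 p.2 w).

Lemma measurable_zeroed Y p : measurable_fun setT (zeroed Y p).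
Proof. by rewrite /zeroed; case: (p \in Y) => //; apply: measurable_maxr. Qed.

Lemma zeroed_ge0 Y p w : 0 <= zeroed Y p w.
Proof. by rewrite /zeroed; case: ifP => // _; rewrite le_max lexx. Qed.

Lemma zeroed_eq0 Y p w : p \in Y -> zeroed Y p w = 0.
Proof. by rewrite /zeroed => ->. Qed.

Lemma rate_gt0 Y p : p \notin Y -> 0 < rate p.
Proof. by rewrite /rate mulr_gt0. Qed.

Section Superset.
Variable Y : {set 'I_m * 'I_n}.
Hypothesis ZY : Z \subset Y.

Lemma zeroed_indep (J : {set 'I_m * 'I_n}) (B : 'I_m * 'I_n -> set R) :
  J \subset (~: Y)%SET -> (forall p, measurable (B p)) ->
  P (\bigcap_(p in [set` J]) zeroed Y p @^-1` B p)%classic =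
  (\prod_(p in J) P (zeroed Y p @^-1` B p)%classic)%E.
Proof.
move=> JY mB; have [_ _ ind] := MP.
have e p : p \in J -> (zeroed Y p @^-1` B p = M p.1 p.2 @^-1` (Num.max 0 @^-1` B p))%classic.
  by move=> /(fintype.subsetP JY); rewrite inE /zeroed => /negbTE pY; apply/funext => w /=; rewrite /preimage /= pY.
rewrite (eq_bigr _ (fun p pJ => congr1 P (e p pJ))).
rewrite (eq_bigcapr (G := fun p => (M p.1 p.2 @^-1` (Num.max 0 @^-1` B p))%classic)); last exact: e.
apply: (ind J (fun p => (Num.max 0 @^-1` B p)%classic)).
  by apply: fintype.subset_trans JY _; rewrite finset.setCS.
move=> p; rewrite -[X in measurable X]setTI; apply: measurable_maxr => //.
Qed.

Lemma zeroed_exp p : p \notin Y -> forall t, 0 <= t ->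
  P [set w | t < zeroed Y p w]%classic = (expR (- (rate p * t)))%:E.
Proof.
move=> pY t t0; have [_ ex _] := MP.
have pZ : (p.1, p.2) \notin Z by rewrite -surjective_pairing; apply: contra pY; apply: (fintype.subsetP ZY).
rewrite -(ex _ _ pZ t t0); congr (P _); apply/funext => w /=.
by rewrite /zeroed (negbTE pY) lt_max ltNge t0.
Qed.

Lemma nice_min_k_zcol j : nice 1 (fun A : 'M[R]_(m, n) => min_k k (zcol j A)).
Proof.
apply: (nice_ext (F := fun B => min_k k (\matrix_(i, l) ((if l == j then fun=> 0 else id) (B i l))))).
  apply: (nice_comp (phi := fun i l => if l == j then fun=> 0 else id)) (nice_min_k _ k_le) _ => // i l.
  by case: ifP => _; split=> // x y; rewrite subrr normr0.
by move=> B; congr (min_k k _); apply/matrixP => i l; rewrite !mxE; case: ifP.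
Qed.

Definition mean_min Y := expect P (zeroed Y) (@min_k R m n k).

(** All the matrices come from the same [M]: zeroing column [j] of the sample for [Y] gives the
    sample for [fill_col Y j]. By linearity the left-hand side is the mean slope, and [expect_slope]
    applies with [row_sum] as [V]. *)
Lemma mean_min_rec :
  \sum_j wC j * (mean_min Y - mean_min (fill_col Y j)) = row_sum k wR Y finset.set0.
Proof.
have mX := measurable_zeroed Y; have X_ge0 := zeroed_ge0 Y; have XZ := fun p w => @zeroed_eq0 Y p w.
have r0 := @rate_gt0 Y.
rewrite -(expect_slope wR_gt0 wC_gt0 k_gt0 k_le mX X_ge0 XZ zeroed_indep zeroed_exp (row_sum_value k_gt0 k_le wR_gt0 Y)).
have i0 := nice_integrable mX X_ge0 XZ r0 zeroed_exp (nice_min_k R k_le).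
have i1 j := nice_integrable mX X_ge0 XZ r0 zeroed_exp (nice_min_k_zcol j).
have idiff j : P.-integrable setT
    (EFin \o (fun w => min_k k (X_mx (zeroed Y) w) - min_k k (zcol j (X_mx (zeroed Y) w)))).
  exact: (integrableB measurableT i0 (i1 j)).
have iterm j : P.-integrable setT
    (EFin \o (fun w => wC j * (min_k k (X_mx (zeroed Y) w) - min_k k (zcol j (X_mx (zeroed Y) w))))).
  exact: (integrableZl measurableT (wC j) (idiff j)).
have ez j : mean_min (fill_col Y j) = expect P (zeroed Y) (fun A => min_k k (zcol j A)).
  apply: eq_Rintegral => w _; congr (min_k k _); apply/matrixP => i l; rewrite !mxE /zeroed !inE /=.
  by case: eqVneq => _; rewrite ?orbT ?orbF.
apply: EFin_inj; rewrite (EFin_expect mX X_ge0 XZ r0 zeroed_exp (nice_slope k_le wC_gt0)).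
under [RHS]eq_integral do rewrite /slope -sumEFin.
rewrite integral_sum//.
rewrite -sumEFin; apply: eq_bigr => j _.
rewrite ez /mean_min /expect -RintegralB//; last exact: i1.
rewrite -(RintegralZl _ measurableT (idiff j)) /Rintegral fineK//.
exact: integrable_fin_num (iterm j).
Qed.

End Superset.

Lemma mean_min_setT : mean_min finset.setT = 0.
Proof.
rewrite /mean_min (_ : expect _ _ _ = expect P (zeroed finset.setT) (fun=> 0)); first exact: expect_cst.
apply: eq_Rintegral => w _.
have [S [aS cS ->]] := min_k_ex k_le (X_mx (zeroed finset.setT) w).
by rewrite /cost big1// => p _; rewrite mxE zeroed_eq0// inE.
Qed.

(** Subtract the two recursions. Columns already full drop out and the other filled sets are settled
    by induction, so the weight of the columns not yet full, times the difference at [Y], is 0. That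
    weight is positive unless [Y] is everything. *)
Lemma mean_minE Y : Z \subset Y -> mean_min Y = full_sum k wR wC Y.
Proof.
have [r] := ubnP #|~: Y|; elim: r Y => // r IH Y /ltnSE leY ZY.
have [YT|] := eqVneq Y finset.setT.
  by rewrite YT mean_min_setT full_sum_setT.
rewrite -finset.subTset => /fintype.subsetPn[[i0 j0] _ ij0].
have fillE j : fill_col Y j = Y \/ mean_min (fill_col Y j) = full_sum k wR wC (fill_col Y j).
  have [full|nfull] := boolP (fill_col Y j \subset Y).
    by left; apply/eqP; rewrite finset.eqEsubset full finset.subsetUl.
  right; apply: IH; last by apply: fintype.subset_trans ZY _; apply: finset.subsetUl.
  apply: leq_trans leY; apply: proper_card; rewrite fintype.properE !finset.setCS finset.subsetUl.
  by [].
have := mean_min_rec ZY; rewrite -(full_sum_rec k_gt0 k_le wR_gt0 wC_gt0) => /eqP.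
rewrite -subr_eq0 -sumrB.
pose open j := fill_col Y j != Y.
rewrite (eq_bigr (fun j => (if open j then wC j else 0) * (mean_min Y - full_sum k wR wC Y))); last first.
  move=> j _; rewrite /open; case: eqVneq => [->|ne]; first by rewrite !subrr mul0r.
  by case: (fillE j) => [e|->]; [rewrite e eqxx in ne|rewrite /=; ring].
rewrite -mulr_suml mulf_eq0 => /orP[|/eqP/subr0_eq//].
rewrite -big_mkcond /= psumr_eq0; last by move=> j _; apply: ltW.
move=> /allP/(_ j0); rewrite mem_index_enum => /(_ isT) /implyP h.
have : wC j0 == 0 by apply: h; apply: contraNneq ij0 => <-; rewrite !inE eqxx orbT.
by rewrite gt_eqF.
Qed.

Lemma zeroed_ae : {ae P, forall w, sample M w = X_mx (zeroed Z) w}.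
Proof.
have [MZ Mexp _] := MP.
have h (p : 'I_m * 'I_n) : {ae P, forall w, M p.1 p.2 w = zeroed Z p w}.
  rewrite /zeroed; have [pZ|pZ] := boolP (p \in Z).
    by apply/nearW => w; apply: MZ; rewrite -surjective_pairing.
  have pY : (p.1, p.2) \notin Z by rewrite -surjective_pairing.
  have mgt : measurable [set w | 0 < M p.1 p.2 w]%classic by apply: measurable_gt.
  exists (~` [set w | 0 < M p.1 p.2 w])%classic; split.
  - exact: measurableC.
  - apply: etrans (probability_setC P mgt) _.
    by rewrite (Mexp _ _ pY 0 (lexx 0)) mulr0 oppr0 expR0 subee.
  - by move=> w /= hw /ltW h0; apply: hw; rewrite max_r.
apply: (filterS _ (filter_forall _ h)) => w hw.
by apply/matrixP => i j; rewrite !mxE -(hw (i, j)).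
Qed.

Lemma expectation_min_k : ('E_P[fun w => min_k k (sample M w)] = (mean_min Z)%:E)%E.
Proof.
rewrite unlock (EFin_expect (measurable_zeroed Z) (zeroed_ge0 Z) (fun p w => @zeroed_eq0 Z p w)
  (@rate_gt0 Z) (zeroed_exp (subxx _)) (nice_min_k _ k_le)).
have mmin := @measurable_min_k R _ _ _ k_le.
apply: ae_eq_integral => //.
- by apply/measurable_EFinP; apply: mmin => i j.
- by apply/measurable_EFinP; apply: (mmin _ _ (fun i j => zeroed Z (i, j))) => i j; apply: measurable_zeroed.
- by apply: filterS zeroed_ae => w -> _.
Qed.

End ZeroedMatrix.

Theorem mainTheorem2 (R : realType) (d : measure_display) (T : measurableType d)
    (P : probability T R) (m n k : nat)
    (wR : 'I_m -> R) (wC : 'I_n -> R) (Z : {set 'I_m * 'I_n})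
    (M : 'I_m -> 'I_n -> {RV P >-> R})
    (wR_gt0 : forall i, 0 < wR i) (wC_gt0 : forall j, 0 < wC j)
    (MP : standard_matrix wR wC Z M)
    (k_gt0 : (0 < k)%N) (k_le : (k <= minn m n)%N) :
  'E_P[fun w => min_k k (sample M w)]%E =
  (\sum_(F : Jk Z k)
     (- mobius (Some F : Jk_hat Z k) \top%O)%:~R /
     (weight wR (~: (val F).1) * weight wC (~: (val F).2)))%:E.
Proof.
rewrite (expectation_min_k wR_gt0 wC_gt0 MP k_le) -full_sum_Jk.
by rewrite (mean_minE wR_gt0 wC_gt0 MP k_gt0 k_le (subxx Z)).
Qed.
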